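(* Let $S_i(t)=r_it+B_i(t)$, $i=1,\dots,d$, where $r_i\in\mathbb R$ and $\boldsymbol B=(B_1,\dots,B_d)^\top$ is a $d$-dimensional Brownian motion with zero drift and $\mathbb E[\boldsymbol B(t)\boldsymbol B(t)^\top]=\boldsymbol\Sigma t$, $\boldsymbol\Sigma=(\sigma_{i,j}^2)_{i,j}$. Put $S=\sum_{i=1}^d S_i$, $r=\sum_{i=1}^d r_i$ and $\sigma^2=\sum_{i,j=1}^d\sigma_{i,j}^2$, assumed strictly positive. Let $u>0$, $0<T<\infty$. Then for every $i\in\{1,\dots,d\}$ the allocation $K_i(u,S,T)$ satisfies $$K_i(u,S,T)=\mathbb E[S_i(\tau(u))\mid\tau(u)\le T]=\mathbb E[\tau(u)\mid\tau(u)\le T]\left(r_i-\frac{\sum_{j=1}^d\sigma_{i,j}^2}{\sigma^2}\,r\right)+\frac{\sum_{j=1}^d\sigma_{i,j}^2}{\sigma^2}\,u,$$ where, for $r\neq 0$, $$\mathbb E[\tau(u)\mid\tau(u)\le T]=\frac{u}{r}\cdot\frac{\Phi\left(\frac{-u+rT}{\sigma\sqrt T}\right)-e^{2ur/\sigma^2}\,\Phi\left(\frac{-u-rT}{\sigma\sqrt T}\right)}{\Phi\left(\frac{-u+rT}{\sigma\sqrt T}\right)+e^{2ur/\sigma^2}\,\Phi\left(\frac{-u-rT}{\sigma\sqrt T}\right)}.$$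
   Context: $d\ge2$. The symbol $\sigma_{i,j}^2$ denotes the $(i,j)$ entry of the covariance matrix $\boldsymbol\Sigma$, with $\sigma_{i,j}^2=\sigma_{j,i}^2=\rho_{i,j}\sigma_{i,i}\sigma_{j,j}$ for correlations $\rho_{i,j}\in[-1,1]$ (so it may be negative for $i\neq j$). $\sigma=\sqrt{\sigma^2}>0$. $\Phi$ is the standard normal distribution function. The ruin time is $\tau(u)=\inf\{t\ge0:S(t)\ge u\}$. The allocation is defined by $$K_i(u,S,T)=c_i(u,S,T)\,u,\qquad c_i(u,S,T)=\frac{\mathbb E[S_i(\tau(u))\mid\tau(u)\le T]}{\mathbb E[S(\tau(u))\mid\tau(u)\le T]}.$$ *)

(* Defs.v *)
From HB Require Import structures.
From mathcomp Require Import all_boot all_order all_algebra.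
From mathcomp Require Import all_classical all_reals all_analysis.

Set Implicit Arguments.
Unset Strict Implicit.
Unset Printing Implicit Defensive.

Import Order.TTheory GRing.Theory Num.Theory.
Import numFieldNormedType.Exports.

Local Open Scope classical_set_scope.
Local Open Scope ring_scope.

Definition Phi (R : realType) (x : R) : R :=
  fine (normal_prob (0 : R) (1 : R) `]-oo, x]%classic).

(* The normal law with mean m and variance v.  The case v = 0 is separate
   because normal_prob m 0 is not the Dirac mass at m. *)
Definition normal_law (R : realType) (m v : R) (A : set R) : \bar R :=
  if v == 0 then \d_m A else normal_prob m (Num.sqrt v) A.

(* A family indexed by a finite type: the sets A k may be the whole space, so
   the product rule over the full index type gives it for all subfamilies. *)
Definition mutually_independent (dO : measure_display)
    (Omega : measurableType dO) (R : realType) (P : probability Omega R)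
    (dT : measure_display) (T : measurableType dT) (I : finType)
    (X : I -> Omega -> T) : Prop :=
  forall A : I -> set T, (forall k, measurable (A k)) ->
    P (\bigcap_(k in [set: I]) (X k @^-1` A k)) =
    (\prod_(k : I) P (X k @^-1` A k))%E.

(* X ~ N(0, C): every linear combination a.X has law N(0, a C a^T), and
   E[X X^T] = C.  The second clause forces C to be symmetric, which the first
   one alone does not. *)
Definition centered_gaussian (dO : measure_display)
    (Omega : measurableType dO) (R : realType) (P : probability Omega R)
    (d : nat) (X : 'I_d -> Omega -> R) (C : 'M[R]_d) : Prop :=
  (forall (a : 'I_d -> R) (A : set R), measurable A ->
     P ((fun w => \sum_(i < d) a i * X i w) @^-1` A) =
     normal_law 0 (\sum_(i < d) \sum_(j < d) a i * a j * C i j) A) /\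
  (forall i j : 'I_d, ('E_P[fun w => (X i w * X j w)%R] = (C i j)%:E)%E).

(* d-dimensional Brownian motion with zero drift and E[B(t) B(t)^T] = t C.
   Time is the half-line [0, +oo[; the values of B at negative times are
   irrelevant.  All paths are continuous, so that hitting times are measurable
   without completing P. *)
Record brownian_motion (dO : measure_display)
    (Omega : measurableType dO) (R : realType) (P : probability Omega R)
    (d : nat) (B : 'I_d -> R -> {RV P >-> R}) (C : 'M[R]_d) : Prop := {
  bm_start : {ae P, forall w, forall i : 'I_d, B i 0 w = 0} ;
  bm_continuous : forall (i : 'I_d) (w : Omega),
    {within `[0, +oo[, continuous (fun t : R => B i t w)} ;
  bm_increment : forall s t : R, 0 <= s -> s < t ->
    centered_gaussian P (fun i w => B i t w - B i s w) ((t - s) *: C) ;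
  bm_independent : forall (n : nat) (t : nat -> R),
    0 <= t 0%N -> (forall k, (k < n)%N -> t k < t k.+1) ->
    mutually_independent P
      (fun (k : 'I_n) (w : Omega) =>
         [tuple B i (t k.+1) w - B i (t k) w | i < d]) }.

(* inf {t >= 0 : S(t) >= u}, equal to +oo if the level u is never reached. *)
Definition ruin_time (Omega : Type) (R : realType) (S : R -> Omega -> R)
    (u : R) (w : Omega) : \bar R :=
  ereal_inf [set t%:E | t in [set t : R | 0 <= t /\ u <= S t w]].

Definition cond_expectation (dO : measure_display)
    (Omega : measurableType dO) (R : realType) (P : probability Omega R)
    (X : Omega -> \bar R) (A : set Omega) : \bar R :=
  ((\int[P]_(w in A) X w) / P A)%E.

Definition aggregate (Omega : Type) (R : realType) (d : nat)
    (S : 'I_d -> R -> Omega -> R) (t : R) (w : Omega) : R :=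
  \sum_(i < d) S i t w.

Definition ruin_event (Omega : Type) (R : realType) (S : R -> Omega -> R)
    (u T : R) : set Omega :=
  [set w | (ruin_time S u w <= T%:E)%E].

(* Y(tau); the value of fine at +oo is irrelevant, as this is only integrated
   over the event tau <= T. *)
Definition stopped (Omega : Type) (R : realType) (Y : R -> Omega -> R)
    (tau : Omega -> \bar R) (w : Omega) : \bar R :=
  (Y (fine (tau w)) w)%:E.

Definition allocation (dO : measure_display)
    (Omega : measurableType dO) (R : realType) (P : probability Omega R)
    (d : nat) (S : 'I_d -> R -> Omega -> R) (u T : R) (i : 'I_d) : \bar R :=
  let tau := ruin_time (aggregate S) u in
  let A := ruin_event (aggregate S) u T in
  (cond_expectation P (stopped (S i) tau) A /
   cond_expectation P (stopped (aggregate S) tau) A * u%:E)%E.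

(* Main.v *)
Require Import Defs.
From mathcomp Require Import all_boot all_order all_algebra.
From mathcomp Require Import all_classical all_reals all_analysis.
From mathcomp Require Import measurable_realfun.
From mathcomp Require Import ring lra.

Import Order.TTheory GRing.Theory Num.Theory.
Import numFieldNormedType.Exports.

Local Open Scope classical_set_scope.
Local Open Scope ring_scope.

Set Implicit Arguments.
Unset Strict Implicit.
Unset Printing Implicit Defensive.

(* The components split as B_i = beta b + W with b = sum_j B_j and W uncorrelated
   with b.  The time tau is a functional of b, and the increments of B after tau
   are centered, so E[B_i(tau); tau <= T] = E[B_i(T); tau <= T]
   = beta E[b(T); tau <= T] = beta E[b(tau); tau <= T], where b(tau) = u - r tau
   because S(tau) = u.  Independence of W and b is only needed in the form
   E[W; b in A] = 0 for one increment: the laws of b + e W and b - e W agree, so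
   E[min(b + e W, c)] is even in e, and its derivative at e = 0 is E[W; b < c].
   For the law of tau, put Y = S(T) - u.  The tilting identity
   E[K(- Z)] = E[exp(- 2 m Z / v) K(Z)] for Z ~ N(m, v), applied to the increment
   of S over [tau, T], is a reflection principle for drifted Brownian motion:
   E[K(- Y); tau <= T] = E[exp(- 2 r Y / sigma^2) K(Y)] when K vanishes on
   ]-oo, 0].  The choice K = 1_{y > 0} gives P(tau <= T, Y < 0) = q, and K = y^+
   gives E[Y; tau <= T], hence E[tau; tau <= T].
   In both arguments tau is replaced by its discretization from above on a mesh of
   step T / (n + 1), and the limit is taken with a bound in L^2. *)

(** * Change of variables for weighted laws *)

(** Conditional expectations and the strong Markov property are replaced by statements on single
    events, [E[Z; tau <= s] = 0]. For a fixed centered [Z] the events with this property form a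
    lambda-system, so it suffices to test boxes in the increments of [b] on a finite grid, where
    independence of increments applies; dyadic grids and path continuity then reach [{tau <= s}].
    Rounding [tau] up makes the event that the rounded time is [k h] depend on the past of [k h]
    only, so it is independent of later increments; the same factorization for squares gives the
    [L^2] bound. The numerator [p - q] comes from two evaluations of [E[Y; tau <= T]]. The positive
    and negative parts of [Y] give [(r T - u) p + (r T + u) q], because their density terms are
    equal and cancel. Stopping the components and using [S(tau) = u] gives [r T (p + q) - r
    E[tau; tau <= T]]. Hence [r E[tau; tau <= T] = u (p - q)], and [r] has to be divided out. Paths
    start at 0 only almost surely, so [S(tau) = u] and the grid form of hitting events hold off a
    null set. *)

Section weighted_laws.
Context {d1 d2 d3 : measure_display} {X1 : measurableType d1}
  {X2 : measurableType d2} {Y : measurableType d3} {R : realType}.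
Variables (m1 : {measure set X1 -> \bar R}) (m2 : {measure set X2 -> \bar R}).

Import HBNNSimple.

Let integral_nnsfun_weight d (X : measurableType d)
    (m : {measure set X -> \bar R}) (p : X -> Y) (w : X -> R)
    (mp : measurable_fun setT p) (mw : measurable_fun setT w)
    (w0 : forall x, 0 <= w x) (h : {nnsfun Y >-> R}) :
  (\int[m]_x (h (p x) * w x)%:E =
   \sum_(r \in range h) r%:E * \int[m]_(x in p @^-1` (h @^-1` [set r])) (w x)%:E)%E.
Proof.
have mhr r : measurable (p @^-1` (h @^-1` [set r])).
  by rewrite -[X in measurable X]setTI; apply: mp => //; exact: measurable_sfunP.
have mi r : measurable_fun setT (fun x => \1_(p @^-1` (h @^-1` [set r])) x * w x : R).
  by apply: measurable_funM => //; exact: measurable_indic.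
transitivity (\int[m]_x (\sum_(r \in range h)
    r%:E * (\1_(p @^-1` (h @^-1` [set r])) x * w x)%:E))%E.
  apply: eq_integral => x _; rewrite (fimfunE h (p x)).
  rewrite EFinM -fsumEFin// muleC ge0_mule_fsumr; last first.
    by move=> r; rewrite EFinM nnfun_muleindic_ge0.
  by apply: eq_fsbigr => r _; rewrite -!EFinM mulrC mulrA.
rewrite ge0_integral_fsum//.
- apply: eq_fsbigr => r; rewrite inE => -[y _ hyr].
  have r0 : (0 <= r)%R by rewrite -hyr.
  rewrite ge0_integralZl//; last 2 first.
  + exact/measurable_EFinP.
  + by move=> x _; rewrite lee_fin mulr_ge0.
  congr (_ * _)%E; rewrite [RHS]integral_mkcond; apply: eq_integral => x _.
  by rewrite patchE indicE; case: ifPn => _; rewrite ?mul1r// mul0r.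
- move=> r; apply: measurable_funeM; exact/measurable_EFinP.
- move=> r x _; rewrite indicE; case: (boolP (_ \in _)) => [|_]; last first.
    by rewrite mul0r mule0.
  by rewrite inE/= => <-; rewrite mul1r -EFinM lee_fin mulr_ge0.
Qed.

(** Level sets of simple functions and monotone convergence extend the equality from preimages. The
    weights let one statement serve for equal laws (weight 1), for independence of an event (its
    indicator against its probability) and for densities (Lebesgue measure weighted by the normal
    density). *)
Lemma eq_weighted_law (p1 : X1 -> Y) (p2 : X2 -> Y) (w1 : X1 -> R) (w2 : X2 -> R)
    (f : Y -> R) :
  measurable_fun setT p1 -> measurable_fun setT p2 ->
  measurable_fun setT w1 -> measurable_fun setT w2 ->
  (forall x, 0 <= w1 x) -> (forall x, 0 <= w2 x) ->
  (forall A, measurable A -> \int[m1]_(x in p1 @^-1` A) (w1 x)%:E =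
     \int[m2]_(x in p2 @^-1` A) (w2 x)%:E)%E ->
  measurable_fun setT f -> (forall y, 0 <= f y) ->
  (\int[m1]_x (f (p1 x) * w1 x)%:E = \int[m2]_x (f (p2 x) * w2 x)%:E)%E.
Proof.
move=> mp1 mp2 mw1 mw2 w10 w20 m12 mf f0.
have mEf : measurable_fun setT (EFin \o f) by exact/measurable_EFinP.
pose h := nnsfun_approx measurableT mEf.
have cvg_int d (X : measurableType d) (m : {measure set X -> \bar R})
    (p : X -> Y) (w : X -> R) : measurable_fun setT p -> measurable_fun setT w ->
    (forall x, 0 <= w x) -> (\int[m]_x (f (p x) * w x)%:E =
    limn (fun n => \int[m]_x (h n (p x) * w x)%:E))%E.
  move=> mp mw w0; rewrite -monotone_convergence//.
  - apply: eq_integral => x _; apply/esym/cvg_lim => //=.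
    rewrite EFinM; under eq_fun do rewrite EFinM.
    apply: cvgeZr => //; apply: (cvg_nnsfun_approx measurableT mEf) => //.
    by move=> y _; rewrite lee_fin.
  - move=> n; apply/measurable_EFinP; apply: measurable_funM => //.
    exact: measurableT_comp.
  - by move=> n x _; rewrite lee_fin mulr_ge0.
  - move=> x _ a b ab; rewrite lee_fin ler_wpM2r//.
    exact/lefP/nd_nnsfun_approx.
rewrite !cvg_int//; congr (limn _); apply/funext => n.
rewrite !integral_nnsfun_weight//; apply: eq_fsbigr => r _; congr (_ * _)%E.
by apply: m12; exact: measurable_sfunP.
Qed.

(** The weights are nonnegative, so the positive and negative parts of the product are those of [f]
    times the weight; each part agrees as an extended real, hence so does the difference. *)
Lemma eq_weighted_law_integral (p1 : X1 -> Y) (p2 : X2 -> Y) (w1 : X1 -> R)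
    (w2 : X2 -> R) (f : Y -> R) :
  measurable_fun setT p1 -> measurable_fun setT p2 ->
  measurable_fun setT w1 -> measurable_fun setT w2 ->
  (forall x, 0 <= w1 x) -> (forall x, 0 <= w2 x) ->
  (forall A, measurable A -> \int[m1]_(x in p1 @^-1` A) (w1 x)%:E =
     \int[m2]_(x in p2 @^-1` A) (w2 x)%:E)%E ->
  measurable_fun setT f ->
  (\int[m1]_x (f (p1 x) * w1 x)%:E = \int[m2]_x (f (p2 x) * w2 x)%:E)%E.
Proof.
move=> mp1 mp2 mw1 mw2 w10 w20 m12 mf.
have pos (X : Type) (p : X -> Y) (w : X -> R) : (forall x, 0 <= w x) ->
    ((fun x => (f (p x) * w x)%:E)^\+)%E =
    (fun x => (Num.max (f (p x)) 0 * w x)%:E).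
  move=> w0; apply/funext => x; rewrite funeposE.
  by rewrite -EFin_max maxr_pMl// mul0r.
have neg (X : Type) (p : X -> Y) (w : X -> R) : (forall x, 0 <= w x) ->
    ((fun x => (f (p x) * w x)%:E)^\-)%E =
    (fun x => (Num.max (- f (p x)) 0 * w x)%:E).
  move=> w0; apply/funext => x; rewrite funenegE -EFinN.
  by rewrite -EFin_max -mulNr maxr_pMl// mul0r.
rewrite integralE [RHS]integralE !pos// !neg//; congr (_ - _)%E.
  by apply: (@eq_weighted_law _ _ w1 w2 (fun y => Num.max (f y) 0)) => //;
    [exact: measurable_maxr|move=> y; rewrite le_max lexx orbT].
apply: (@eq_weighted_law _ _ w1 w2 (fun y => Num.max (- f y) 0)) => //.
  by apply: measurable_maxr => //; exact: measurableT_comp.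
by move=> y; rewrite le_max lexx orbT.
Qed.

End weighted_laws.

(** * Integrals over finite measure spaces *)

Lemma measurable_preimage {d d' : measure_display} {T : measurableType d}
    {Y : measurableType d'} (f : T -> Y) (A : set Y) :
  measurable_fun setT f -> measurable A -> measurable (f @^-1` A).
Proof. by move=> mf mA; rewrite -[X in measurable X]setTI; exact: mf. Qed.

Section cvg_lattice.
Context {R : realType} {T : Type} {F : set_system T} {FF : Filter F}.

Lemma cvg_maxr (f g : T -> R) (a b : R) : f @ F --> a -> g @ F --> b ->
  (fun x => Num.max (f x) (g x)) @ F --> Num.max a b.
Proof.
move=> fa gb; under eq_fun do rewrite maxr_absE; rewrite maxr_absE.
apply: cvgMr_tmp; apply: cvgD; first exact: cvgD.
by apply: cvg_norm; exact: cvgB.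
Qed.

Lemma cvg_minr (f g : T -> R) (a b : R) : f @ F --> a -> g @ F --> b ->
  (fun x => Num.min (f x) (g x)) @ F --> Num.min a b.
Proof.
move=> fa gb; under eq_fun do rewrite minr_absE; rewrite minr_absE.
apply: cvgMr_tmp; apply: cvgB; first exact: cvgD.
by apply: cvg_norm; exact: cvgB.
Qed.

End cvg_lattice.

Section integrability.
Context {d : measure_display} {T : measurableType d} {R : realType}.
Variable P : {finite_measure set T -> \bar R}.

Lemma dominated_integrable_R (A : set T) (f g : T -> R) : measurable A ->
  measurable_fun A f -> (forall x, A x -> `|f x| <= g x) ->
  P.-integrable A (EFin \o g) -> P.-integrable A (EFin \o f).
Proof.
move=> mA mf fg; apply: le_integrable => //; first exact/measurable_EFinP.
by move=> x Ax /=; rewrite lee_fin (le_trans (fg _ Ax))// ler_norm.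
Qed.

Lemma bounded_integrable_R (A : set T) (f : T -> R) (M : R) : measurable A ->
  measurable_fun A f -> (forall x, A x -> `|f x| <= M) ->
  P.-integrable A (EFin \o f).
Proof.
move=> mA mf fM; apply: (@dominated_integrable_R _ _ (cst M)) => //.
exact: finite_measure_integrable_cst.
Qed.

Lemma sqr_integrable_R (A : set T) (f : T -> R) : measurable A ->
  measurable_fun A f -> P.-integrable A (EFin \o (fun x => (f x ^+ 2)%R)) ->
  P.-integrable A (EFin \o f).
Proof.
move=> mA mf f2; apply: (@dominated_integrable_R _ _ (fun x => (1 + f x ^+ 2)%R)) => //.
  move=> x _; rewrite -[f x ^+ 2]real_normK ?num_real//.
  by have := sqr_ge0 (`|f x| - 1); have := normr_ge0 (f x); nra.
rewrite [X in P.-integrable _ X](_ : _ =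
  ((EFin \o cst 1%R) \+ (EFin \o (fun x => (f x ^+ 2)%R)))%E)//.
by apply: integrableD => //; exact: finite_measure_integrable_cst.
Qed.

Lemma Rintegral_dominated_cvg (A : set T) (f_ : nat -> T -> R) (f g : T -> R) :
  measurable A -> (forall n, measurable_fun A (f_ n)) -> measurable_fun A f ->
  P.-integrable A (EFin \o g) ->
  {ae P, forall x, A x -> f_ ^~ x @ \oo --> f x} ->
  (forall n x, A x -> `|f_ n x| <= g x) ->
  P.-integrable A (EFin \o f) /\
  (fun n => \int[P]_(x in A) f_ n x) @ \oo --> \int[P]_(x in A) f x.
Proof.
move=> mA mf_ mf ig cf fg.
have intf_ n : P.-integrable A (EFin \o f_ n).
  by apply: (@dominated_integrable_R _ _ g) => // x; exact: fg.
have [] := @dominated_convergence _ _ _ P A mA (fun n => EFin \o f_ n) (EFin \o f)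
  (EFin \o g).
- by move=> n; exact/measurable_EFinP.
- exact/measurable_EFinP.
- by apply: filterS cf => x cfx Ax; apply: cvg_EFin; [exact: nearW|exact: cfx].
- by [].
- by apply: aeW => x n Ax; rewrite /= lee_fin; exact: fg.
move=> intf _ H; split => //.
rewrite /Rintegral; apply: fine_cvg; rewrite fineK; last exact: integrable_fin_num.
exact: H.
Qed.

Definition clamp (M z : R) : R := Num.max (- M) (Num.min M z).

(** Where the truncation acts, [|z| > M], so the error is less than [|z| <= z ^+ 2 / M]. A
    second-moment bound [C] thus makes the truncation error at most [C / M], uniformly along a
    sequence. *)
Lemma clamp_err (M z : R) : 0 < M -> `|z - clamp M z| <= z ^+ 2 / M.
Proof.
move=> M0; rewrite /clamp ler_pdivlMr//.
have [Mz|zM] := leP M z.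
  rewrite max_r; last lra.
  rewrite ger0_norm; last lra.
  have h1 : 0 <= (z - M) * z by apply: mulr_ge0; lra.
  by have := sqr_ge0 M; lra.
have [Mz|zM'] := leP (- M) z; first by rewrite subrr normr0 mul0r sqr_ge0.
rewrite ltr0_norm; last lra.
have h1 : 0 <= (- M - z) * (- z) by apply: mulr_ge0; lra.
by have := sqr_ge0 M; lra.
Qed.

Lemma clamp_bound (M z : R) : 0 < M -> `|clamp M z| <= M.
Proof.
move=> M0; rewrite /clamp ler_norml.
have [Mz|zM] := leP M z; first by rewrite max_r; [apply/andP; split; lra|lra].
by have [zM'|zM'] := leP (- M) z; apply/andP; split; lra.
Qed.

Lemma cvg_clamp (M : R) (u_ : nat -> R) (l : R) :
  u_ @ \oo --> l -> (fun n => clamp M (u_ n)) @ \oo --> clamp M l.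
Proof.
move=> ul; apply: cvg_maxr; first exact: cvg_cst.
by apply: cvg_minr => //; exact: cvg_cst.
Qed.

(** Boundedness in [L^2] gives uniform integrability: truncating at [M] costs at most [C / M] for
    every term and for the limit, and the truncated functions converge under the constant bound [M].
    Fatou's lemma transfers the bound [C] to the limit. *)
Lemma L2_bounded_cvg (A : set T) (f_ : nat -> T -> R) (f : T -> R) (C : R) :
  measurable A -> (forall n, measurable_fun A (f_ n)) -> measurable_fun A f ->
  (forall x, A x -> f_ ^~ x @ \oo --> f x) -> 0 <= C ->
  (forall n, \int[P]_(x in A) (f_ n x ^+ 2)%:E <= C%:E)%E ->
  P.-integrable A (EFin \o f) /\
  (fun n => \int[P]_(x in A) f_ n x) @ \oo --> \int[P]_(x in A) f x.
Proof.
move=> mA mf_ mf cf C0 f_C.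
have fC : (\int[P]_(x in A) (f x ^+ 2)%:E <= C%:E)%E.
  have := @fatou _ _ _ P A mA (fun n x => (f_ n x ^+ 2)%:E).
  have mf2 n : measurable_fun A (fun x => (f_ n x ^+ 2)%:E).
    by apply/measurable_EFinP; exact: measurable_funX.
  move=> /(_ mf2 (fun n x _ => sqr_ge0 (f_ n x))).
  rewrite (_ : (\int[P]_(x in A) limn_einf _)%E = \int[P]_(x in A) (f x ^+ 2)%:E)%E.
    move=> /le_trans; apply; rewrite limn_einf_lim; apply: lime_le.
      exact: is_cvg_einfs.
    apply: nearW => n; apply: (le_trans _ (f_C n)); apply: ereal_inf_lbound.
    by exists n => /=.
  apply: eq_integral => x; rewrite inE => Ax.
  apply: (cvg_limn_einf_sup _).1.
  apply: cvg_EFin; first exact: nearW.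
  by under eq_fun do rewrite /= expr2; rewrite expr2; apply: cvgM; exact: cf.
have int2 (g : T -> R) : measurable_fun A g -> (\int[P]_(x in A) (g x ^+ 2)%:E <= C%:E)%E ->
    P.-integrable A (EFin \o (fun x => (g x ^+ 2)%R)).
  move=> mg gC; apply/integrableP; split.
    by apply/measurable_EFinP; exact: measurable_funX.
  rewrite (le_lt_trans _ (ltry C))//; apply: le_trans gC.
  by under eq_integral do rewrite /= ger0_norm ?sqr_ge0//.
have intf : P.-integrable A (EFin \o f) by apply: sqr_integrable_R => //; exact: int2.
have intf_ n : P.-integrable A (EFin \o f_ n).
  by apply: sqr_integrable_R => //; exact: int2.
split=> //.
have mclamp M (g : T -> R) : measurable_fun A g -> measurable_fun A (fun x => clamp M (g x)).
  by move=> mg; apply: measurable_maxr => //; exact: measurable_minr.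
have err M (g : T -> R) : 0 < M -> measurable_fun A g -> P.-integrable A (EFin \o g) ->
    (\int[P]_(x in A) (g x ^+ 2)%:E <= C%:E)%E ->
    P.-integrable A (EFin \o (fun x => clamp M (g x))) /\
    `|\int[P]_(x in A) g x - \int[P]_(x in A) clamp M (g x)| <= C / M.
  move=> M0 mg ig gC.
  have ic : P.-integrable A (EFin \o (fun x => clamp M (g x))).
    apply: (@bounded_integrable_R _ _ M) => //; first exact: mclamp.
    by move=> x _; exact: clamp_bound.
  split=> //; rewrite -RintegralB//.
  have i2 := int2 _ mg gC.
  have iB : P.-integrable A (EFin \o (fun x => g x - clamp M (g x))).
    by have := integrableB mA ig ic.
  apply: (le_trans (le_normr_Rintegral mA iB)).
  have i2M : P.-integrable A (EFin \o (fun x => (g x ^+ 2 / M)%R)).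
    have := integrableZr mA M^-1 i2; apply: eq_integrable => // x _ /=.
  apply: (@le_trans _ _ (\int[P]_(x in A) (g x ^+ 2 / M))).
    apply: le_Rintegral => //; last by move=> x _; exact: clamp_err.
    exact: integrable_norm.
  rewrite RintegralZr// ler_pM2r ?invr_gt0//.
  by rewrite -lee_fin /Rintegral fineK//; exact: integrable_fin_num.
apply/cvgrPdist_lt => e e0.
(* Each of the two truncation errors falls below [e / 4], as does the error from dominated
   convergence; [C + 1] keeps [M] positive when [C = 0]. *)
pose M := 4 * (C + 1) / e.
have M0 : 0 < M by rewrite divr_gt0// mulr_gt0//; lra.
have CM : C / M < e / 4.
  rewrite ltr_pdivrMr// /M; rewrite [ltRHS](_ : _ = C + 1); first lra.
  by field; lra.
have [icf ef] := err M f M0 mf intf fC.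
have [_ ccvg] := @Rintegral_dominated_cvg A (fun n x => clamp M (f_ n x))
  (fun x => clamp M (f x)) (cst M) mA (fun n => mclamp M _ (mf_ n)) (mclamp M _ mf)
  (finite_measure_integrable_cst P M mA)
  (aeW _ (fun x Ax => @cvg_clamp M _ _ (cf x Ax)))
  (fun n x _ => clamp_bound _ M0).
move/cvgrPdist_lt : ccvg => /(_ (e / 4) (divr_gt0 e0 (ltr0n _ 4))).
apply: filterS => n cn.
have [_ en] := err M (f_ n) M0 (mf_ n) (intf_ n) (f_C n).
move: ef en cn.
rewrite !ler_norml !ltr_norml => /andP[a1 a2] /andP[a3 a4] /andP[a5 a6].
by apply/andP; split; lra.
Qed.

End integrability.

(** * Integrals determined by laws and by independence *)

Section laws.
Context {d d' : measure_display} {T : measurableType d} {Y : measurableType d'}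
  {R : realType}.
Variable P : probability T R.

Lemma eq_law_Rintegral (X1 X2 : T -> Y) (f : Y -> R) :
  measurable_fun setT X1 -> measurable_fun setT X2 -> measurable_fun setT f ->
  (forall A, measurable A -> P (X1 @^-1` A) = P (X2 @^-1` A)) ->
  \int[P]_x f (X1 x) = \int[P]_x f (X2 x).
Proof.
move=> mX1 mX2 mf X12; rewrite /Rintegral; congr fine.
have mul1 (X : T -> Y) :
    (\int[P]_x (f (X x))%:E = \int[P]_x (f (X x) * cst 1 x)%:E)%E.
  by apply: eq_integral => x _; rewrite mulr1.
rewrite (mul1 X1) (mul1 X2).
apply: (@eq_weighted_law_integral _ _ _ _ _ _ _ P P X1 X2 (cst 1) (cst 1) f) => //.
move=> A mA.
have m1 := measurable_preimage mX1 mA; have m2 := measurable_preimage mX2 mA.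
rewrite (integral_cst P m1 1%E) (integral_cst P m2 1%E).
by congr (_ * _)%E; exact: X12.
Qed.

(** Independence says that [X] has the same weighted law under the weight [\1_E] and under the
    constant weight [P E]. *)
Lemma indep_Rintegral (E : set T) (X : T -> Y) (f : Y -> R) : measurable E ->
  measurable_fun setT X -> measurable_fun setT f ->
  P.-integrable setT (EFin \o (f \o X)) ->
  (forall A, measurable A -> P (E `&` X @^-1` A) = (P E * P (X @^-1` A))%E) ->
  \int[P]_(x in E) f (X x) = fine (P E) * \int[P]_x f (X x).
Proof.
move=> mE mX mf fX EX.
have PE : P E \is a fin_num by exact: fin_num_measure.
have PE0 : 0 <= fine (P E) by exact: fine_ge0.
have H := @eq_weighted_law_integral _ _ _ _ _ _ _ P P X X (\1_E : T -> R)
  (cst (fine (P E))) f mX mX (measurable_indic mE) (@measurable_cst _ _ _ _ _ _).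
have {}H : (\int[P]_x (f (X x) * \1_E x)%:E =
    \int[P]_x (f (X x) * fine (P E))%:E)%E.
  apply: H => //.
  move=> A mA; have mXA := measurable_preimage mX mA.
  rewrite integral_indic// (integral_cst P mXA (fine (P E))%:E) fineK//.
  exact: EX.
rewrite /Rintegral integral_mkcond.
transitivity (fine (\int[P]_x (f (X x) * \1_E x)%:E)).
  congr fine; apply: eq_integral => x _; rewrite patchE indicE.
  by case: ifPn; rewrite ?mulr1// mulr0.
rewrite H.
transitivity (fine (\int[P]_x ((fine (P E))%:E * (f (X x))%:E))).
  by congr fine; apply: eq_integral => x _; rewrite mulrC EFinM.
by rewrite integralZl// fineM//; exact: integrable_fin_num.
Qed.

End laws.

(** * Gaussian densities and laws *)

Section normal.
Context {R : realType}.
Local Notation mu := (@lebesgue_measure R).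
Variable s : R.
Hypothesis s0 : 0 < s.

Let sn0 : s != 0. Proof. by rewrite gt_eqF. Qed.

Lemma normal_pdf0E (x : R) :
  normal_pdf 0 s x = normal_peak s * expR (- x ^+ 2 / (s ^+ 2 *+ 2)).
Proof. by rewrite normal_pdfE// /normal_fun subr0. Qed.

Lemma normal_pdf0N (x : R) : normal_pdf 0 s (- x) = normal_pdf 0 s x.
Proof. by rewrite !normal_pdf0E sqrrN. Qed.

Lemma normal_pdf0_scale (x : R) : normal_pdf 0 s x = normal_pdf 0 1 (x / s) * s^-1.
Proof.
rewrite normal_pdf0E normal_pdfE ?oner_eq0// /normal_fun subr0.
have -> : normal_peak s = normal_peak 1 * s^-1.
  rewrite /normal_peak expr1n mul1r -mulrnAr sqrtrM ?sqr_ge0//.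
  by rewrite sqrtr_sqr gtr0_norm// invfM mulrC.
rewrite mulrAC; congr (_ * expR _ * _).
by field; rewrite sn0.
Qed.

Lemma normal_prob_gt0 (c : R) : (0 < normal_prob 0 s `[c, +oo[)%E.
Proof.
(* [|x| <= M] on [[c, c + 1]], so [m] bounds the density from below on this interval of length 1. *)
pose M := `|c| + 1.
pose m := normal_peak s * expR (- M ^+ 2 / (s ^+ 2 *+ 2)).
have m0 : 0 < m by rewrite mulr_gt0// ?expR_gt0// normal_peak_gt0.
apply: (@lt_le_trans _ _ (\int[mu]_(x in `[c, (c + 1)%R]) (cst m%:E x)))%E.
  rewrite integral_cst//= lebesgue_measure_itv/= lte_fin ltrDl ltr01.
  by rewrite -EFinB addrAC subrr add0r mule1 lte_fin.
apply: (@le_trans _ _ (\int[mu]_(x in `[c, (c + 1)%R]) (normal_pdf 0 s x)%:E))%E.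
  apply: ge0_le_integral => //=.
  - by move=> x _; rewrite lee_fin ltW.
  - by apply/measurable_EFinP/measurable_funTS; exact: measurable_normal_pdf.
  - move=> x; rewrite in_itv/= => /andP[cx xc]; rewrite lee_fin normal_pdf0E.
    rewrite ler_wpM2l ?normal_peak_ge0// ler_expR !mulNr lerN2.
    rewrite ler_wpM2r ?invr_ge0 ?mulrn_wge0 ?sqr_ge0//.
    rewrite -[x ^+ 2]real_normK ?num_real// ler_sqr ?nnegrE ?addr_ge0//.
    rewrite /M ler_norml; have := ler_norm c; have := ler_norm (- c).
    by rewrite normrN => h1 h2; apply/andP; split; lra.
apply: ge0_subset_integral => //=.
- by apply/measurable_EFinP/measurable_funTS; exact: measurable_normal_pdf.
- by move=> x _; rewrite lee_fin normal_pdf_ge0.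
- by move=> x /=; rewrite !in_itv/= => /andP[-> _].
Qed.

Lemma normal_prob_Phi (x : R) : normal_prob 0 s `]-oo, x] = (Phi (x / s))%:E.
Proof.
rewrite /Phi fineK; last exact: fin_num_measure.
rewrite /normal_prob.
pose F (y : R) := y / s.
have F'E : F^`()%classic = cst s^-1.
  apply/funext => y; rewrite /F derive1E deriveM// derive_cst scaler0 add0r.
  by rewrite derive_id scaler1.
have := @increasing_ge0_integration_by_substitutionNy R F (normal_pdf 0 1) x.
rewrite F'E => ->.
- apply: eq_integral => y _; rewrite /= normal_pdf0_scale//.
- by move=> a b _ _ ab; rewrite /F ltr_pM2r// invr_gt0.
- by move=> y _; exact: cvg_cst.
- exact: is_cvg_cst.
- exact: cvg_cst.
- split=> //.
  by apply: cvgMr_tmp; apply: cvg_at_left_filter; exact: cvg_id.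
- by apply: gt0_cvgMlNy; [rewrite invr_gt0|exact: cvg_id].
- apply: continuous_subspaceT; apply: continuous_normal_pdf; exact: oner_neq0.
- by move=> y _; exact: normal_pdf_ge0.
Qed.

Lemma is_derive_normal_pdf (x : R) :
  is_derive x 1 (fun y : R => - s ^+ 2 * normal_pdf 0 s y) (x * normal_pdf 0 s x).
Proof.
pose k := - (s ^+ 2 *+ 2)^-1.
rewrite [X in is_derive _ _ X](_ : _ =
    (fun y : R => (- s ^+ 2 * normal_peak s) * expR (k * y ^+ 2))); last first.
  apply/funext => y; rewrite normal_pdf0E mulrA; congr (_ * expR _).
  by rewrite /k; field; rewrite sn0.
rewrite normal_pdf0E.
apply: is_derive_eq.
rewrite /GRing.scale/= /k.
have -> : - (s ^+ 2 *+ 2)^-1 * x ^+ 2 = - x ^+ 2 / (s ^+ 2 *+ 2).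
  by field; rewrite sn0.
by field; rewrite sn0.
Qed.

Lemma cvg_normal_pdfy : normal_pdf 0 s x @[x --> +oo] --> (0 : R).
Proof.
have k0 : 0 < (Num.sqrt (s ^+ 2 *+ 2))^-1.
  by rewrite invr_gt0 sqrtr_gt0 pmulrn_lgt0// exprn_gt0.
rewrite (_ : normal_pdf 0 s = (fun x : R => normal_peak s *
    gauss_fun (x * (Num.sqrt (s ^+ 2 *+ 2))^-1))); last first.
  apply/funext => x; rewrite normal_pdf0E; congr (_ * expR _).
  by rewrite exprMn exprVn sqr_sqrtr ?mulrn_wge0 ?sqr_ge0// mulNr.
rewrite -[X in _ --> X](mulr0 (normal_peak s)); apply: cvgMl_tmp.
apply: (cvg_comp (fun x : R => x * (Num.sqrt (s ^+ 2 *+ 2))^-1) gauss_fun).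
  by apply: gt0_cvgMly => //; exact: cvg_id.
exact: cvg_gauss_fun.
Qed.

(** [- s ^+ 2 * normal_pdf 0 s] is an antiderivative of the integrand and vanishes at infinity;
    [0 <= c] makes the integrand nonnegative, as the improper fundamental theorem applied here
    requires. *)
Lemma normal_tail_moment (c : R) : 0 <= c ->
  (\int[mu]_(x in `[c, +oo[) (x * normal_pdf 0 s x)%:E =
   (s ^+ 2 * normal_pdf 0 s c)%:E)%E.
Proof.
move=> c0.
have cpdf : continuous (normal_pdf 0 s) by exact: continuous_normal_pdf.
rewrite (@ge0_continuous_FTC2y _ _ (fun y : R => - s ^+ 2 * normal_pdf 0 s y) c 0).
- by rewrite -EFinB sub0r mulNr opprK.
- by move=> x cx; rewrite mulr_ge0 ?normal_pdf_ge0// (le_trans c0).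
- apply: continuous_subspaceT => x; apply: cvgM; first exact: cvg_id.
  exact: cpdf.
- by rewrite -[X in _ --> X](mulr0 (- s ^+ 2)); apply: cvgMl_tmp; exact: cvg_normal_pdfy.
- by move=> x _; exact: (@ex_derive _ _ _ _ _ _ _ (is_derive_normal_pdf x)).
- apply: cvg_at_right_filter; apply: cvgMl_tmp; exact: cpdf.
- by move=> x _; rewrite derive1E; exact: (@derive_val _ _ _ _ _ _ _ (is_derive_normal_pdf x)).
Qed.

End normal.

(** * Invariance of Lebesgue measure under reflection *)

Section lebesgue_reflection.
Context {R : realType}.
Local Notation mu := (@lebesgue_measure R).

Lemma lebesgue_measure_reflect (c : R) (A : set R) : measurable A ->
  pushforward mu (fun x : R => c - x : measurableTypeR R) A = mu A.
Proof.
move=> mA; apply/esym/lebesgue_measure_unique => //=.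
  exact: measurable_funB.
move=> _ _ [[a b]] _ <-.
rewrite /pushforward.
(* Reflection turns a left-open interval into a right-open one of the same length. *)
rewrite [X in _ = mu X](_ : _ = `[(c - b)%R, (c - a)%R[%classic).
  rewrite !lebesgue_measure_itv/= !lte_fin ltrD2l ltrN2.
  by case: ifP => // _; rewrite -!EFinD; congr EFin; ring.
by apply/seteqP; split => x /=; rewrite !in_itv/= => /andP[h1 h2]; apply/andP; split; lra.
Qed.

Lemma ge0_integral_reflect (c : R) (f : R -> R) : measurable_fun setT f ->
  (forall x, 0 <= f x) -> (\int[mu]_x (f (c - x))%:E = \int[mu]_x (f x)%:E)%E.
Proof.
move=> mf f0.
have mc : measurable_fun setT (fun x : R => c - x : measurableTypeR R).
  exact: measurable_funB.
transitivity (\int[pushforward mu (fun x : R => (c - x)%R : measurableTypeR R)]_x (f x)%:E)%E.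
  rewrite ge0_integral_pushforward//; first exact/measurable_EFinP.
  by move=> y _; rewrite lee_fin.
by apply: eq_measure_integral => A mA _; exact: lebesgue_measure_reflect.
Qed.

End lebesgue_reflection.

(** * A centered Gaussian variable: tilting, symmetry, tails *)

Section gaussian_variable.
Context {d : measure_display} {T : measurableType d} {R : realType}.
Variable P : probability T R.
Local Notation mu := (@lebesgue_measure R).
Variables (s : R) (N : T -> R).
Hypotheses (s0 : 0 < s) (mN : measurable_fun setT N).
Hypothesis lawN : forall A, measurable A -> P (N @^-1` A) = normal_prob 0 s A.

Let mpdf : measurable_fun setT (normal_pdf 0 s).
Proof. exact: measurable_normal_pdf. Qed.

Lemma ge0_integral_gaussian (f : R -> R) : measurable_fun setT f ->
  (forall x, 0 <= f x) ->
  (\int[P]_w (f (N w))%:E = \int[mu]_x (f x * normal_pdf 0 s x)%:E)%E.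
Proof.
move=> mf f0.
transitivity (\int[P]_w (f (N w) * cst 1 w)%:E)%E.
  by apply: eq_integral => w _; rewrite mulr1.
apply: (@eq_weighted_law _ _ _ _ _ _ _ P mu N id (cst 1) (normal_pdf 0 s) f) => //.
- by move=> x; exact: normal_pdf_ge0.
- move=> A mA; rewrite (integral_cst P (measurable_preimage mN mA) 1%E) mul1e.
  exact: lawN.
Qed.

(** The substitution [x -> - 2 m - x] preserves Lebesgue measure and changes the sign of [m + x];
    the ratio of the normal densities at [- 2 m - x] and at [x] is [exp(- 2 m (m + x) / s^2)]. *)
Lemma gaussian_tilt (m : R) (K : R -> R) : measurable_fun setT K ->
  (forall x, 0 <= K x) ->
  (\int[P]_w (K (- (m + N w)))%:E =
   \int[P]_w (expR (- (2 * m / s ^+ 2) * (m + N w)) * K (m + N w))%:E)%E.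
Proof.
move=> mK K0.
rewrite (@ge0_integral_gaussian (fun x => K (- (m + x))))//; last first.
  by apply: measurableT_comp => //; apply: measurableT_comp => //; exact: measurable_funD.
rewrite (@ge0_integral_gaussian
  (fun x => expR (- (2 * m / s ^+ 2) * (m + x)) * K (m + x))); last 2 first.
- apply: measurable_funM.
    apply: measurableT_comp => //; apply: measurable_funM => //.
    exact: measurable_funD.
  by apply: measurableT_comp => //; exact: measurable_funD.
- by move=> x; rewrite mulr_ge0// expR_ge0.
rewrite -(@ge0_integral_reflect _ (- (2 * m)) (fun x => K (- (m + x)) * _)).
- apply: eq_integral => x _; congr EFin.
  rewrite (_ : - (m + (- (2 * m) - x)) = m + x); last by ring.
  rewrite mulrAC mulrC; congr (_ * _).
  rewrite !normal_pdf0E// mulrCA -expRD; congr (_ * expR _).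
  by field; rewrite gt_eqF.
- apply: measurable_funM => //.
  by apply: measurableT_comp => //; apply: measurableT_comp => //; exact: measurable_funD.
- by move=> x; rewrite mulr_ge0// normal_pdf_ge0.
Qed.

(** The case [m = 0] of the tilting identity, where the exponential factor is 1. *)
Lemma gaussian_sym (A : set R) : measurable A ->
  P ((fun w => - N w) @^-1` A) = P (N @^-1` A).
Proof.
move=> mA; have mA' := measurable_preimage mN mA.
have mNN : measurable_fun setT (fun w => - N w) by exact: measurableT_comp.
have PE (g : T -> R) : measurable_fun setT g ->
    P (g @^-1` A) = (\int[P]_w (\1_A (g w))%:E)%E.
  move=> mg; rewrite [RHS](_ : _ = \int[P]_w (\1_(g @^-1` A) w)%:E)%E.
    by rewrite integral_indic ?setIT//; exact: measurable_preimage.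
  by [].
rewrite !PE//.
have := @gaussian_tilt 0 (\1_A) (measurable_indic mA) (fun x => ler0n _ _).
rewrite (_ : (fun w => (\1_A (- (0 + N w)))%:E) = (fun w => (\1_A (- N w))%:E)).
  move=> ->; apply: eq_integral => w _.
  by rewrite add0r mulr0 mul0r oppr0 mul0r expR0 mul1r.
by apply/funext => w; rewrite add0r.
Qed.

Lemma gaussian_set1 (c : R) : P (N @^-1` [set c]) = 0%E.
Proof. by rewrite lawN// /normal_prob integral_set1. Qed.

Lemma gaussian_le (x : R) : P [set w | N w <= x] = (Phi (x / s))%:E.
Proof.
rewrite -normal_prob_Phi// -lawN//.
Qed.

Lemma gaussian_ge (x : R) : P [set w | x <= N w] = (Phi (- x / s))%:E.
Proof.
rewrite -normal_prob_Phi// -lawN// -gaussian_sym//; congr (P _).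
by apply/seteqP; split => w /=; rewrite in_itv/= lerN2.
Qed.

Lemma gaussian_ge_gt0 (c : R) : (0 < P [set w | (c <= N w)%R])%E.
Proof.
rewrite (_ : [set w | _] = N @^-1` `[c, +oo[) ?lawN ?normal_prob_gt0//.
by apply/seteqP; split => w /=; rewrite in_itv/= andbT.
Qed.

End gaussian_variable.

(** * Expected positive parts of shifted Gaussian variables *)

Section gaussian_moments.
Context {d : measure_display} {T : measurableType d} {R : realType}.
Variable P : probability T R.
Local Notation mu := (@lebesgue_measure R).
Variables (s : R).
Hypothesis s0 : 0 < s.

(** By symmetry both tails of [N] are values of [Phi], and the boundary point [x] carries no
    mass. *)
Lemma Phi_compl (N : T -> R) (x : R) : measurable_fun setT N ->
  (forall A, measurable A -> P (N @^-1` A) = normal_prob 0 s A) ->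
  Phi (- x / s) = 1 - Phi (x / s).
Proof.
move=> mN lawN.
have mge : measurable [set w | x <= N w].
  rewrite (_ : [set w | _] = N @^-1` `[x, +oo[); first exact: measurable_preimage.
  by apply/seteqP; split => w /=; rewrite in_itv/= andbT.
have h1 := gaussian_le s0 lawN x.
have h2 := gaussian_ge s0 mN lawN x.
have : P [set w | N w <= x] = P (~` [set w | x <= N w] `|` N @^-1` [set x]).
  congr (P _); apply/seteqP; split => w /=.
    by rewrite le_eqVlt => /orP[/eqP->|h]; [right|left; apply/negP; rewrite -ltNge].
  by move=> [/negP|->//]; rewrite -ltNge => /ltW.
rewrite measureU0; last 3 first.
- exact: measurableC.
- exact: measurable_preimage.
- exact: (gaussian_set1 lawN).
move=> h3; have {h3} := etrans h3 (probability_setC P mge).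
rewrite h1 h2 => -[h3].
by rewrite h3; ring.
Qed.

(** This is Bachelier's formula. For [a <= 0] the identity [x = (x + a) + (- a)] on [[- a, +oo[] has
    nonnegative terms, so the tail moment and the tail probability [Phi (a / s)] determine the
    value. *)
Lemma gaussian_call_npos (N : T -> R) (a : R) : measurable_fun setT N ->
  (forall A, measurable A -> P (N @^-1` A) = normal_prob 0 s A) -> a <= 0 ->
  (\int[P]_w (Num.max (N w + a) 0)%:E =
   (s ^+ 2 * normal_pdf 0 s a + a * Phi (a / s))%:E)%E.
Proof.
move=> mN lawN a0.
rewrite (@ge0_integral_gaussian _ _ _ P s N mN lawN (fun x => Num.max (x + a) 0)); last 2 first.
- by apply: measurable_maxr => //; exact: measurable_funD.
- by move=> x; rewrite le_max lexx orbT.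
have mpdf : measurable_fun setT (normal_pdf 0 s) by exact: measurable_normal_pdf.
have -> : (\int[mu]_x (Num.max (x + a) 0 * normal_pdf 0 s x)%:E =
    \int[mu]_(x in `[(- a)%R, +oo[) ((x + a) * normal_pdf 0 s x)%:E)%E.
  rewrite [RHS]integral_mkcond; apply: eq_integral => x _; rewrite patchE.
  case: ifPn; rewrite ?inE/= ?notin_setE/= in_itv/= andbT.
    by move=> h; rewrite max_l//; lra.
  by move=> /negP; rewrite -ltNge => h; rewrite max_r ?mul0r//; lra.
have na0 : 0 <= - a by lra.
have := normal_tail_moment s0 na0.
rewrite normal_pdf0N//.
rewrite (_ : (\int[mu]_(x in _) _)%E =
   (\int[mu]_(x in `[(- a)%R, +oo[) (((x + a) * normal_pdf 0 s x)%:E +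
     (- a)%:E * (normal_pdf 0 s x)%:E)))%E; last first.
  by apply: eq_integral => x _; rewrite -EFinM -EFinD; congr EFin; ring.
rewrite ge0_integralD//=; last 4 first.
- by move=> x; rewrite in_itv/= andbT => h; rewrite lee_fin mulr_ge0 ?normal_pdf_ge0//; lra.
- apply/measurable_EFinP/measurable_funTS; apply: measurable_funM => //.
  exact: measurable_funD.
- by move=> x _; rewrite -EFinM lee_fin mulr_ge0// normal_pdf_ge0.
- by apply: measurable_funeM; apply/measurable_EFinP/measurable_funTS.
rewrite ge0_integralZl_EFin//; last 2 first.
- by move=> x _; rewrite lee_fin normal_pdf_ge0.
- by apply/measurable_EFinP/measurable_funTS.
have -> : (\int[mu]_(x in `[(- a)%R, +oo[) (normal_pdf 0 s x)%:E = (Phi (a / s))%:E)%E.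
  rewrite -[LHS]/(normal_prob 0 s `[- a, +oo[) -lawN//.
  rewrite -[a in RHS]opprK -(gaussian_ge s0 mN lawN); congr (P _).
  by apply/seteqP; split => w /=; rewrite in_itv/= andbT.
move=> h; rewrite -EFinM in h.
have fin : (\int[mu]_(x in `[(- a)%R, +oo[) ((x + a) * normal_pdf 0 s x)%:E)%E \is a fin_num.
  apply: contra_eqT h; rewrite fin_numE negb_and !negbK => /orP[]/eqP->.
    by rewrite addNye.
  by rewrite addye.
rewrite -(fineK fin) in h *; move: h; rewrite -EFinD => -[h]; congr EFin.
by lra.
Qed.

Lemma gaussian_call (N : T -> R) (a : R) : measurable_fun setT N ->
  (forall A, measurable A -> P (N @^-1` A) = normal_prob 0 s A) ->
  (\int[P]_w (Num.max (N w + a) 0)%:E =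
   (s ^+ 2 * normal_pdf 0 s a + a * Phi (a / s))%:E)%E.
Proof.
move=> mN lawN; have [a0|a0] := leP a 0; first exact: gaussian_call_npos.
have mNN : measurable_fun setT (fun w => - N w) by exact: measurableT_comp.
have lawNN A : measurable A -> P ((fun w => - N w) @^-1` A) = normal_prob 0 s A.
  by move=> mA; rewrite (gaussian_sym s0 mN lawN)// lawN.
have mmax (M : T -> R) b : measurable_fun setT M ->
    measurable_fun setT (fun w => (Num.max (M w + b) 0)%:E).
  move=> mM; apply/measurable_EFinP/measurable_maxr => //.
  exact: measurable_funD.
(* Put-call parity, arranged with nonnegative terms so that the integrals add in the extended reals.
   It reduces [a > 0] to the shifts [0] and [- a]; the two terms with shift [0] cancel. *)
have H : (\int[P]_w ((Num.max (N w + a) 0)%:E + (Num.max (- N w + 0) 0)%:E) =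
    \int[P]_w (((Num.max (N w + 0) 0)%:E + a%:E) + (Num.max (- N w + - a) 0)%:E))%E.
  apply: eq_integral => w _; rewrite -!EFinD; congr EFin; rewrite !addr0.
  by have [h1|h1] := leP (N w + a) 0; have [h2|h2] := leP (- N w) 0;
    have [h3|h3] := leP (N w) 0; have [h4|h4] := leP (- N w + - a) 0; lra.
have ge0max x : (0 <= (Num.max x 0)%:E :> \bar R)%E by rewrite lee_fin le_max lexx orbT.
move: H; rewrite !ge0_integralD//; try exact: mmax;
  try (by move=> w _; rewrite lee_fin ltW);
  try (by move=> w _; rewrite adde_ge0// lee_fin ltW);
  try (by apply: emeasurable_funD => //; exact: mmax).
rewrite !(@gaussian_call_npos _ 0)// (@gaussian_call_npos (fun w => - N w) (- a))//; last by lra.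
have acst : (\int[P]_w (cst a%:E w) = a%:E)%E.
  by rewrite (integral_cst P measurableT a%:E); rewrite [X in (_ * X)%E]probability_setT mule1.
rewrite !mul0r !addr0 acst.
rewrite (@Phi_compl N)// normal_pdf0N// => h.
have fin : (\int[P]_w (Num.max (N w + a) 0)%:E)%E \is a fin_num.
  apply: contra_eqT h; rewrite fin_numE negb_and !negbK => /orP[]/eqP->.
    by rewrite addNye.
  by rewrite addye.
rewrite -(fineK fin) in h *; move: h; rewrite -!EFinD => -[h]; congr EFin.
by lra.
Qed.

End gaussian_moments.

(** * Events carrying a null integral *)

Section null_class.
Context {d : measure_display} {T : measurableType d} {R : realType}.
Variable P : probability T R.
Variable Z : T -> R.
Hypotheses (iZ : P.-integrable setT (EFin \o Z)) (Z0 : \int[P]_w Z w = 0).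

(** Stands in for [E[Z | F] = 0] with a sigma-algebra [F]: collecting single events gives access to
    pi-lambda arguments and monotone limits. *)
Definition null_class (E : set T) : Prop :=
  measurable E /\ \int[P]_(w in E) Z w = 0.

Let iZE E : measurable E -> P.-integrable E (EFin \o Z).
Proof. by move=> mE; apply: integrableS iZ. Qed.

Let mZ : measurable_fun setT Z.
Proof. by apply/measurable_EFinP; exact: measurable_int iZ. Qed.

Lemma null_class_setD (A B : set T) : null_class A -> null_class B ->
  B `<=` A -> null_class (A `\` B).
Proof.
move=> [mA A0] [mB B0] BA; split; first exact: measurableD.
have mD : measurable (A `\` B) by exact: measurableD.
have AE : A = (A `\` B) `|` B by rewrite setUC setDUK.
move: A0; rewrite {1}AE Rintegral_setU//.
- by rewrite B0 addr0.
- by rewrite -AE; exact: iZE.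
- by apply/disj_setPS => x [[_ nB]].
Qed.

(** Dominated convergence with bound [|Z|]: at each point the indicators of the [F n] are eventually
    constant. *)
Lemma null_class_ndseq (F : nat -> set T) : nondecreasing_seq F ->
  (forall n, null_class (F n)) -> null_class (\bigcup_n F n).
Proof.
move=> ndF DF.
have mF n : measurable (F n) by case: (DF n).
have mU : measurable (\bigcup_n F n) by exact: bigcupT_measurable.
split => //; rewrite Rintegral_mkcond.
have mr E : measurable E -> measurable_fun setT (Z \_ E).
  by move=> mE; apply/(measurable_restrictT _ mE); exact: measurable_funTS.
have FU n : F n `<=` \bigcup_n F n by exact: bigcup_sup.
have cF w : (fun n => (Z \_ (F n)) w) @ \oo --> (Z \_ (\bigcup_n F n)) w.
  apply: cvg_near_cst; rewrite patchE.
  have [|nw] := boolP (w \in \bigcup_n F n).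
    rewrite inE => -[N _ FNw]; exists N => // n /= Nn; rewrite patchE mem_set//.
    by move/subsetPset: (ndF _ _ Nn); exact.
  apply: nearW => n; rewrite patchE memNset// => /FU Uw.
  by move: nw; rewrite mem_set.
have bF n w : setT w -> `|(Z \_ (F n)) w| <= `|Z w|.
  by move=> _; rewrite patchE; case: ifP; rewrite ?normr0.
have [_ H] := @Rintegral_dominated_cvg _ _ _ P setT (fun n => Z \_ (F n))
  (Z \_ (\bigcup_n F n)) (fun w => `|Z w|) measurableT (fun n => mr _ (mF n)) (mr _ mU)
  (integrable_norm iZ) (aeW _ (fun w _ => cF w)) bF.
rewrite -(cvg_lim _ H)//.
under eq_fun do rewrite -Rintegral_mkcond (DF _).2.
exact: lim_cst.
Qed.

Lemma null_class_lambda_system : lambda_system setT null_class.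
Proof.
split => //.
- by move=> A B BA DA DB; exact: null_class_setD.
- by move=> F ndF DF; exact: null_class_ndseq.
Qed.

Lemma null_classC (A : set T) : null_class A -> null_class (~` A).
Proof.
move=> DA; rewrite -setTD; exact: null_class_setD.
Qed.

Lemma null_class_niseq (F : nat -> set T) : nonincreasing_seq F ->
  (forall n, null_class (F n)) -> null_class (\bigcap_n F n).
Proof.
move=> niF DF; rewrite -(setCK (\bigcap_n F n)); apply: null_classC.
rewrite setC_bigcap; apply: null_class_ndseq => [m n mn|n].
  by apply/subsetPset/subsetC/subsetPset/niF.
exact: null_classC.
Qed.

(** A null set changes no integral; this absorbs the paths that do not start at 0. *)
Lemma null_class_ae (E F N : set T) : null_class E -> measurable F ->
  measurable N -> P N = 0%E -> E `\` N = F `\` N -> null_class F.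
Proof.
move=> [mE E0] mF mN PN EF; split => //.
rewrite /Rintegral (negligible_integral mN mF _ PN); last exact: iZE.
by rewrite -EF -(negligible_integral mN mE _ PN)//; exact: iZE.
Qed.

Section grid.
Variables (n : nat) (D : nat -> T -> R).

Definition box (A : nat -> set R) : set T :=
  [set w | forall k, (k < n)%N -> A k (D k w)].

Definition boxes : set (set T) :=
  [set E | exists2 A, (forall k, measurable (A k)) & E = box A].

Lemma boxes_setI : setI_closed boxes.
Proof.
move=> _ _ [A mA ->] [B mB ->]; exists (fun k => A k `&` B k).
  by move=> k; exact: measurableI.
apply/seteqP; split => [w [Aw Bw] k kn|w ABw]; first by split; [exact: Aw|exact: Bw].
by split => k kn; have [] := ABw k kn.
Qed.

(** Boxes are stable under intersection, so by the pi-lambda theorem the null class contains the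
    sigma-algebra they generate, for which partial sums of at most [n] terms are measurable. In the
    application [J] selects the grid times up to [t] and [c] absorbs the drift. *)
Lemma null_class_partial_sums (J : nat -> Prop) (c : nat -> R) :
  boxes `<=` null_class ->
  null_class [set w | exists2 i, (i <= n)%N /\ J i & c i < \sum_(k < i) D k w].
Proof.
move=> HB.
have : <<s boxes >> `<=` null_class.
  by apply: lambda_system_subset => //; [exact: boxes_setI|exact: null_class_lambda_system].
apply.
(* [T'] is the same space with the sigma-algebra generated by the boxes, so membership in
   [<<s boxes >>] becomes measurability in [T']. *)
pose T' := g_sigma_algebraType boxes.
have mD k : (k < n)%N -> measurable_fun (setT : set T') (D k).
  move=> kn _ A mA; rewrite setTI; apply: sub_sigma_algebra.
  exists (fun j => if j == k then A else setT).
    by move=> j; case: ifP.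
  apply/seteqP; split => [w Aw j jn|w Aw].
    by case: eqP => // ->.
  by have := Aw k kn; rewrite eqxx.
have mS i : (i <= n)%N -> measurable_fun (setT : set T') (fun w => \sum_(k < i) D k w).
  move=> i_n; apply: measurable_sum => k; apply: mD.
  by rewrite (leq_trans _ i_n).
rewrite (_ : [set w | _] = \bigcup_(i in [set i | (i <= n)%N /\ J i])
    ((fun w => \sum_(k < i) D k w) @^-1` `]c i, +oo[)); last first.
  apply/seteqP; split => [w [i iJ ci]|w [i iJ ci]]; exists i => //.
    by rewrite /= in_itv/= andbT.
  by move: ci; rewrite /= in_itv/= andbT.
suff : @measurable _ T' (\bigcup_(i in [set i | (i <= n)%N /\ J i])
    ((fun w => \sum_(k < i) D k w) @^-1` `]c i, +oo[)) by [].
apply: bigcup_measurable => i [i_n _].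
by apply: measurable_preimage => //; exact: mS.
Qed.

End grid.

End null_class.

(** * Hitting events *)

Section paths.
Context {R : realType}.

Lemma natSinv_lt (e : R) : 0 < e -> exists n : nat, n.+1%:R^-1 < e.
Proof.
move=> e0; have [N _ /(_ N (leqnn _))] := near_infty_natSinv_lt (PosNum e0).
by exists N.
Qed.

Lemma within_continuous_eps (f : R -> R) :
  {within `[0, +oo[, continuous f} -> forall s e, 0 <= s -> 0 < e ->
  exists2 del, 0 < del & forall t, 0 <= t -> `|t - s| < del -> `|f t - f s| < e.
Proof.
move=> /subspace_continuousP cf s e s0 e0.
have /cvgrPdist_lt/(_ _ e0) := cf s ltac:(by rewrite /= in_itv/= s0).
rewrite near_withinE => -[del /= del0 H]; exists del => // t t0 ts.
rewrite distrC; apply: H; last by rewrite /= in_itv/= t0.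
by rewrite /ball/= distrC.
Qed.

Lemma within_continuous_max (f : R -> R) (t : R) :
  {within `[0, +oo[, continuous f} -> 0 <= t ->
  exists2 c, 0 <= c <= t & forall s, 0 <= s <= t -> f s <= f c.
Proof.
move=> cf t0.
have ne : `[0, t] !=set0 by exists 0; rewrite /= in_itv/= lexx.
have cft : {within `[0, t], continuous f}.
  by apply: continuous_subspaceW cf => x /=; rewrite !in_itv/= andbT => /andP[].
have [c] := compact_EVT_max ne (@segment_compact R 0 t) cft.
rewrite inE/= in_itv/= => ct H; exists c => // s st; apply: H.
by rewrite inE/= in_itv.
Qed.

Lemma within_continuous_cvg (f : R -> R) (s : R) (t_ : nat -> R) :
  {within `[0, +oo[, continuous f} -> 0 <= s -> (forall n, 0 <= t_ n) ->
  t_ @ \oo --> s -> (f \o t_) @ \oo --> f s.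
Proof.
move=> cf s0 t0 ts; apply/cvgrPdist_lt => e e0.
have [del del0 H] := within_continuous_eps cf s0 e0.
move/cvgrPdist_lt : ts => /(_ _ del0); apply: filterS => n ns.
by rewrite /= distrC H// distrC.
Qed.

(** [i] is the integer part of [s / (S / 2 ^+ j)]. Rounding down keeps the grid point in every
    interval [[0, t]] that contains [s]. *)
Lemma dyadic_approx (S s del : R) : 0 < S -> 0 <= s <= S -> 0 < del ->
  exists j i : nat, [/\ (i <= 2 ^ j)%N, i%:R * (S / 2 ^+ j) <= s &
    `|i%:R * (S / 2 ^+ j) - s| < del].
Proof.
move=> S0 /andP[s0 sS] del0.
have [j Hj] : exists j : nat, S / 2 ^+ j < del.
  have [N HN] := natSinv_lt (divr_gt0 del0 S0).
  exists N.+1; rewrite -ltr_pdivlMl// [S^-1 * del]mulrC.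
  apply: le_lt_trans HN; rewrite lef_pV2 ?posrE ?exprn_gt0 ?ltr0n//.
  by rewrite -natrX ler_nat ltnW// ltn_expl.
have h0 : 0 < S / 2 ^+ j by rewrite divr_gt0// exprn_gt0.
have q0 : 0 <= s / (S / 2 ^+ j) by rewrite divr_ge0// ltW.
exists j, (Num.trunc (s / (S / 2 ^+ j))).
have /andP[h1 h2] := truncn_itv q0.
rewrite ler_pdivlMr// in h1; rewrite ltr_pdivrMr// in h2.
split => //.
  rewrite truncn_le_nat ltr_pdivrMr//.
  apply: (le_lt_trans sS); rewrite -natr1 natrX mulrDl mul1r mulrC divfK; last first.
    by rewrite expf_neq0// pnatr_eq0.
  by rewrite ltrDl.
rewrite -natr1 mulrDl mul1r in h2.
by rewrite ler0_norm; lra.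
Qed.

End paths.

Definition continuous_paths {T : Type} {R : realType} (X : R -> T -> R) : Prop :=
  forall w, {within `[0, +oo[, continuous (X ^~ w)}.

Section hitting.
Context {d : measure_display} {T : measurableType d} {R : realType}.
Variables (X : R -> T -> R) (u : R).
Hypothesis cX : continuous_paths X.
Hypothesis mX : forall t, measurable_fun setT (X t).

Definition hit (t : R) : set T := [set w | exists2 s, 0 <= s <= t & u <= X s w].

(** The level is lowered by [1 / (m + 1)] because a path may touch [u] only off the grid; nearby
    grid points then see a value just below [u]. *)
Definition dyadic_hit (S t : R) (m j : nat) : set T :=
  [set w | exists2 i, (i <= 2 ^ j)%N /\ i%:R * (S / 2 ^+ j) <= t &
    u - m.+1%:R^-1 < X (i%:R * (S / 2 ^+ j)) w].

(** Continuity at a hitting time puts a grid value above each lowered level. Conversely the maximum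
    over [[0, t]] is attained; were it below [u], some lowered level would exceed it and no grid
    value could pass that level. *)
Lemma hit_dyadic (S t : R) : 0 < S -> 0 <= t <= S ->
  hit t = \bigcap_m \bigcup_j dyadic_hit S t m j.
Proof.
move=> S0 /andP[t0 tS]; apply/seteqP; split => [w [s /andP[s0 st] us] m _|w H].
  have e0 : 0 < m.+1%:R^-1 :> R by rewrite invr_gt0.
  have [del del0 Hdel] := within_continuous_eps (@cX w) s0 e0.
  have [|j [i [ij is_ isd]]] := @dyadic_approx _ S s del S0 _ del0.
    by rewrite s0 (le_trans st).
  exists j => //; exists i; first by split => //; exact: le_trans st.
  have i0 : 0 <= i%:R * (S / 2 ^+ j).
    by rewrite mulr_ge0// divr_ge0// ?exprn_ge0// ltW.
  have := Hdel _ i0 isd; rewrite ltr_norml => /andP[+ _].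
  rewrite ltrBrDr addrC; apply: le_lt_trans.
  by rewrite lerD2r.
have [c ct Hc] := within_continuous_max (@cX w) t0.
exists c => //; rewrite leNgt; apply/negP => uc.
have uc0 : 0 < u - X c w by lra.
have [m Hm] := natSinv_lt uc0.
have [j _ [i [ij it] Hi]] := H m I.
have := Hc (i%:R * (S / 2 ^+ j)); rewrite it andbT.
have -> : 0 <= i%:R * (S / 2 ^+ j) by rewrite mulr_ge0// divr_ge0// ?exprn_ge0// ltW.
move=> /(_ isT) h; move: Hi; rewrite ltNge => /negP; apply.
by apply: (le_trans h); rewrite lerBrDr addrC -lerBrDr ltW.
Qed.

Lemma dyadic_hit_nd (S t : R) m : nondecreasing_seq (dyadic_hit S t m).
Proof.
apply/nondecreasing_seqP => j; apply/subsetPset => w [i [ij it] Hi].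
have E : (2 * i)%:R * (S / 2 ^+ j.+1) = i%:R * (S / 2 ^+ j).
  by rewrite exprS natrM; field; rewrite expf_neq0.
exists (2 * i)%N; rewrite E//; split => //.
by rewrite expnS leq_mul2l.
Qed.

Lemma dyadic_hit_ni (S t : R) :
  nonincreasing_seq (fun m => \bigcup_j dyadic_hit S t m j).
Proof.
move=> m n mn; apply/subsetPset => w [j _ [i ij Hi]]; exists j => //; exists i => //.
apply: le_lt_trans Hi; rewrite lerD2l lerN2 lef_pV2 ?posrE ?ltr0n//.
by rewrite ler_nat.
Qed.

Lemma measurable_dyadic_hit (S t : R) m j : measurable (dyadic_hit S t m j).
Proof.
rewrite (_ : dyadic_hit _ _ _ _ = \bigcup_(i in [set i : nat | (i <= 2 ^ j)%N /\
    i%:R * (S / 2 ^+ j) <= t])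
    (X (i%:R * (S / 2 ^+ j)) @^-1` `]u - m.+1%:R^-1, +oo[)); last first.
  apply/seteqP; split => [w [i iJ ci]|w [i iJ ci]]; exists i => //.
    by rewrite /= in_itv/= andbT.
  by move: ci; rewrite /= in_itv/= andbT.
by apply: bigcup_measurable => i _; exact: measurable_preimage.
Qed.

Lemma measurable_hit (t : R) : measurable (hit t).
Proof.
have [t0|t0] := leP 0 t; last first.
  rewrite (_ : hit t = set0)//; apply/seteqP; split => // w [s /andP[]]; lra.
(* The horizon [t + 1] keeps the mesh positive at [t = 0]. *)
have S0 : 0 < t + 1 by lra.
have tS : 0 <= t <= t + 1 by rewrite t0 lerDl ler01.
rewrite (hit_dyadic S0 tS).
apply: bigcapT_measurable => m; apply: bigcupT_measurable => j.
exact: measurable_dyadic_hit.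
Qed.

Variable P : probability T R.

Lemma null_class_hit (Z : T -> R) (S t : R) :
  P.-integrable setT (EFin \o Z) -> \int[P]_w Z w = 0 -> 0 < S -> 0 <= t <= S ->
  (forall m j, null_class P Z (dyadic_hit S t m j)) -> null_class P Z (hit t).
Proof.
move=> iZ Z0 S0 tS DZ; rewrite (hit_dyadic S0 tS).
apply: null_class_niseq => //; first exact: dyadic_hit_ni.
by move=> m; apply: null_class_ndseq => //; exact: dyadic_hit_nd.
Qed.

End hitting.

(** * Stopping at the ruin time *)

Section stopping.
Context {d : measure_display} {T : measurableType d} {R : realType}.
Variables (X : R -> T -> R) (u : R).
Hypothesis cX : continuous_paths X.
Hypothesis mX : forall t, measurable_fun setT (X t).

Lemma hit_neg (t : R) : t < 0 -> hit X u t = set0.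
Proof. by move=> t0; apply/seteqP; split => // w [s /andP[]]; lra. Qed.

Lemma hit_le (s t : R) : s <= t -> hit X u s `<=` hit X u t.
Proof. by move=> st w [r /andP[r0 rs] ur]; exists r; rewrite // r0 (le_trans rs). Qed.

Lemma ruin_time_ge0 w : (0 <= ruin_time X u w)%E.
Proof. by apply: le_ereal_inf_tmp => _ [t [t0 _] <-]; rewrite lee_fin. Qed.

(** On continuous paths a finite infimum is attained: if [u] is not reached by time [t], the path
    stays below [u] up to some [t + del], which then bounds the infimum from below. *)
Lemma ruin_time_le (t : R) w : 0 <= t -> (ruin_time X u w <= t%:E)%E <-> hit X u t w.
Proof.
move=> t0; split => [h|[s /andP[s0 st] us]]; last first.
  apply: (@le_trans _ _ s%:E); last by rewrite lee_fin.
  by apply: ereal_inf_lbound; exists s.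
apply: contrapT => nh.
have Xlt s : 0 <= s <= t -> X s w < u.
  by move=> st; rewrite ltNge; apply/negP => us; apply: nh; exists s.
have ut : 0 < u - X t w by have := Xlt t; rewrite lexx t0 => /(_ isT); lra.
have [del del0 H] := within_continuous_eps (@cX w) t0 ut.
have : ((t + del)%:E <= ruin_time X u w)%E.
  apply: le_ereal_inf_tmp => _ [s [s0 us] <-]; rewrite lee_fin leNgt; apply/negP => sd.
  have [st|ts] := leP s t; first by have := Xlt s; rewrite s0 st => /(_ isT); lra.
  have := H s s0; rewrite gtr0_norm ?subr_gt0// ltr_norml => /(_ _)/andP[]; lra.
by move=> /le_trans/(_ h); rewrite lee_fin; lra.
Qed.

Variables (T0 : R).
Hypothesis T00 : 0 < T0.
Local Notation A := (hit X u T0).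
Local Notation tau := (fun w => fine (ruin_time X u w)).

Lemma ruin_time_fin w : A w -> ruin_time X u w = (tau w)%:E.
Proof.
move=> /ruin_time_le h; rewrite fineK//.
rewrite ge0_fin_numE ?ruin_time_ge0// (le_lt_trans (h _)) ?ltry//; exact: ltW.
Qed.

Lemma tau_itv w : A w -> 0 <= tau w <= T0.
Proof.
move=> Aw; rewrite -!lee_fin -ruin_time_fin// ruin_time_ge0/=.
by apply/ruin_time_le => //; exact: ltW.
Qed.

Lemma tau_le w (t : R) : A w -> tau w <= t <-> hit X u t w.
Proof.
move=> Aw; have [t0|t0] := leP 0 t.
  by rewrite -lee_fin -ruin_time_fin//; exact: ruin_time_le.
rewrite hit_neg//; split => //; have /andP[h _] := tau_itv Aw; lra.
Qed.

(** A value above [u] at [tau] would, by continuity, be preceded by another one; this needs room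
    before [tau], and [X 0 w < u] supplies it. *)
Lemma tau_level w : X 0 w < u -> A w -> X (tau w) w = u.
Proof.
move=> X0 Aw; have /andP[t0 tT] := tau_itv Aw.
have [s /andP[s0 st] us] : hit X u (tau w) w by apply/tau_le.
have stau : s = tau w.
  by apply/eqP; rewrite eq_le st/=; apply/(tau_le _ Aw); exists s; rewrite // s0 lexx.
apply/eqP; rewrite eq_le -{2}stau us andbT leNgt; apply/negP => uX.
have e0 : 0 < X (tau w) w - u by lra.
have [del del0 H] := within_continuous_eps (@cX w) t0 e0.
have tau0 : 0 < tau w.
  rewrite lt_neqAle t0 andbT; apply/eqP => h; move: uX; rewrite -h; lra.
(* A time in [[0, tau)] at distance less than [del] from [tau]. *)
pose s' := Num.max 0 (tau w - del / 2).
have s'0 : 0 <= s' by rewrite le_max lexx.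
have s'tau : s' < tau w by rewrite gt_max tau0/=; lra.
have s'd : tau w - del / 2 <= s' by rewrite le_max lexx orbT.
have := H s' s'0; rewrite ltr0_norm; last by lra.
rewrite ltr_norml => /(_ _)/andP[]; first by lra.
move=> h _; have : tau w <= s'.
  by apply/(tau_le _ Aw); exists s'; [rewrite s'0 lexx|lra].
by lra.
Qed.

Definition mesh (n : nat) : R := T0 / n.+1%:R.

(** The event [(k - 1) h < tau <= k h] for the mesh [h], determined by the path up to [k h]. At
    [k = 0] the removed event is empty, its time being negative. *)
Definition hit_step (n k : nat) : set T :=
  hit X u (k%:R * mesh n) `\` hit X u (k%:R * mesh n - mesh n).

(** [F] at [tau] rounded up to the grid when [tau <= T0], and 0 otherwise; [k] runs up to [n + 1]
    because [(n + 1) h = T0]. *)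
Definition disc (n : nat) (F : R -> T -> R) (w : T) : R :=
  \sum_(k < n.+2) \1_(hit_step n k) w * F (k%:R * mesh n) w.

Lemma mesh_gt0 n : 0 < mesh n.
Proof. by rewrite divr_gt0. Qed.

Lemma mesh_max n : n.+1%:R * mesh n = T0.
Proof. by rewrite /mesh mulrC divfK. Qed.

Lemma mesh_itv n (k : 'I_n.+2) : 0 <= k%:R * mesh n <= T0.
Proof.
rewrite mulr_ge0 ?ler0n ?(ltW (mesh_gt0 n))//= -[leRHS](mesh_max n).
by rewrite ler_wpM2r ?(ltW (mesh_gt0 n))// ler_nat -ltnS.
Qed.

Lemma measurable_hit_step n k : measurable (hit_step n k).
Proof. by apply: measurableD; exact: measurable_hit. Qed.

Lemma hit_step_sub n (k : 'I_n.+2) : hit_step n k `<=` A.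
Proof. by move=> w [h _]; apply: hit_le h; have /andP[] := mesh_itv k. Qed.

Lemma hit_step_ex n w : A w -> exists k0 : 'I_n.+2,
  [/\ `|k0%:R * mesh n - tau w| <= mesh n &
    forall k : 'I_n.+2, \1_(hit_step n k) w = (k == k0)%:R :> R].
Proof.
move=> Aw; have /andP[t0 tT] := tau_itv Aw; have h0 := mesh_gt0 n.
have ex : exists k : nat, tau w <= k%:R * mesh n by exists n.+1; rewrite mesh_max.
(* The least index with [tau <= k h], so that also [k0 h - h < tau]. *)
have [k0 k0P k0min] := ex_minnP ex.
have k0n : (k0 < n.+2)%N by rewrite ltnS; apply: k0min; rewrite mesh_max.
have low : k0%:R * mesh n - mesh n < tau w.
  case: k0 k0P k0min k0n => [|k] kP kmin _; first by rewrite mul0r; lra.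
  rewrite -natr1 mulrDl mul1r addrK ltNge; apply/negP => /kmin.
  by rewrite ltnn.
exists (Ordinal k0n); split.
  by rewrite ger0_norm/=; [lra|rewrite subr_ge0].
move=> k; rewrite indicE; congr (nat_of_bool _)%:R; apply/idP/eqP => [|->].
  rewrite inE => -[/(tau_le _ Aw) h1 h2]; apply/val_inj/eqP; rewrite eqn_leq /=.
  rewrite (k0min _ h1) andbT leqNgt; apply/negP => k0k; apply: h2.
  apply/(tau_le _ Aw); apply: (le_trans k0P).
  rewrite -[X in _ - X]mul1r -mulrBl ler_wpM2r ?(ltW h0)//.
  by rewrite lerBrDr natr1 ler_nat.
rewrite inE; split; first exact/(tau_le _ Aw).
by move=> /(tau_le _ Aw); rewrite leNgt low.
Qed.

(** One grid time serves every [F], so discretization commutes with squaring on [A]. *)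
Lemma disc_ex n w : A w -> exists t : R, [/\ 0 <= t <= T0, `|t - tau w| <= mesh n &
  forall F, disc n F w = F t w].
Proof.
move=> Aw; have [k0 [h1 h2]] := hit_step_ex n Aw.
exists (k0%:R * mesh n); split => //; first exact: mesh_itv.
move=> F; rewrite /disc (bigD1 k0)//= big1 ?addr0.
  by rewrite h2 eqxx mul1r.
by move=> k kk0; rewrite h2 (negbTE kk0) mul0r.
Qed.

Definition seq_continuous (F : R -> T -> R) : Prop :=
  forall w s (t_ : nat -> R), 0 <= s <= T0 -> (forall n, 0 <= t_ n <= T0) ->
    t_ @ \oo --> s -> (fun n => F (t_ n) w) @ \oo --> F s w.

Lemma cvg_disc (F : R -> T -> R) w : seq_continuous F -> A w ->
  (fun n => disc n F w) @ \oo --> F (tau w) w.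
Proof.
move=> cF Aw.
have /choice[t_ tP] n := @disc_ex n w Aw.
rewrite (_ : (fun n => _) = (fun n => F (t_ n) w)); last first.
  by apply/funext => n; have [_ _ ->] := tP n.
apply: cF; first exact: tau_itv.
  by move=> n; have [] := tP n.
apply/cvgrPdist_lt => e e0.
have [N HN] := natSinv_lt (divr_gt0 e0 T00).
exists N => // n /= Nn; rewrite distrC.
have [_ + _] := tP n; move=> /le_lt_trans; apply.
rewrite /mesh -ltr_pdivlMl// mulrC; apply: le_lt_trans HN.
by rewrite lef_pV2 ?posrE// ler_nat.
Qed.

Lemma measurable_disc n F : (forall t, 0 <= t <= T0 -> measurable_fun setT (F t)) ->
  measurable_fun setT (disc n F).
Proof.
move=> mF; apply: measurable_sum => k; apply: measurable_funM.
  by apply: measurable_indic; exact: measurable_hit_step.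
by apply: mF; exact: mesh_itv.
Qed.

Lemma measurable_stopped (F : R -> T -> R) : seq_continuous F ->
  (forall t, 0 <= t <= T0 -> measurable_fun setT (F t)) ->
  measurable_fun A (fun w => F (tau w) w).
Proof.
move=> cF mF; apply: (@measurable_fun_cvg _ _ _ _ (fun n => disc n F)).
  by move=> n; apply: measurable_funTS; exact: measurable_disc.
by move=> w Aw; exact: cvg_disc.
Qed.

Variable P : probability T R.

Lemma Rintegral_disc n F :
  (forall t, 0 <= t <= T0 -> P.-integrable setT (EFin \o F t)) ->
  P.-integrable A (EFin \o disc n F) /\
  \int[P]_(w in A) disc n F w =
  \sum_(k < n.+2) \int[P]_(w in hit_step n k) F (k%:R * mesh n) w.
Proof.
move=> iF; have mA := measurable_hit u cX mX T0.
have iE (k : 'I_n.+2) :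
    P.-integrable A (EFin \o (fun w => \1_(hit_step n k) w * F (k%:R * mesh n) w)).
  have iFk : P.-integrable A (EFin \o F (k%:R * mesh n)).
    by apply: integrableS (iF _ (mesh_itv k)).
  apply: (dominated_integrable_R mA _ _ (integrable_norm iFk)).
    apply: measurable_funM; first by apply: measurable_indic; exact: measurable_hit_step.
    by apply/measurable_EFinP; exact: measurable_int iFk.
  move=> w _ /=; rewrite normrM indicE; case: (_ \in _); rewrite ?normr1 ?mul1r//.
  by rewrite normr0 mul0r.
have EFs : EFin \o disc n F =
    (fun w => \sum_(k < n.+2) (\1_(hit_step n k) w * F (k%:R * mesh n) w)%:E)%E.
  by apply/funext => w /=; rewrite /disc sumEFin.
split; first by rewrite EFs; apply: integrable_sum => // k _; exact: iE.
rewrite /Rintegral.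
transitivity (fine (\sum_(k < n.+2) (\int[P]_(w in hit_step n k)
    F (k%:R * mesh n) w)%:E)%E); last by rewrite sumEFin.
congr fine.
rewrite (_ : (fun w => (disc n F w)%:E) = EFin \o disc n F)// EFs integral_sum//.
apply: eq_bigr => k _.
rewrite /Rintegral fineK; last first.
  apply: integrable_fin_num; first exact: measurable_hit_step.
  by apply: integrableS (iF _ (mesh_itv k)) => //; exact: measurable_hit_step.
rewrite -[in RHS](setIidr (@hit_step_sub n k)).
rewrite integral_mkcondr; apply: eq_integral => w _; rewrite patchE indicE.
by case: (w \in _); rewrite ?mul1r// mul0r.
Qed.

(** Optional stopping for [F t] that behaves like a centered function of the increment over
    [[t, T0]]. On each step the integral vanishes and the integral of the square factorizes; summed
    over the disjoint steps this bounds the second moment of the discretization by [C], and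
    [L2_bounded_cvg] passes to [tau]. *)
Lemma stopped_martingale (F : R -> T -> R) (C : R) : seq_continuous F ->
  (forall t, 0 <= t <= T0 -> measurable_fun setT (F t)) ->
  (forall t, 0 <= t <= T0 ->
    P.-integrable setT (EFin \o (fun w => (F t w ^+ 2)%R))) -> 0 <= C ->
  (forall t, 0 <= t <= T0 -> \int[P]_w (F t w ^+ 2) <= C) ->
  (forall s t, 0 <= s <= t -> t <= T0 -> \int[P]_(w in hit X u s) F t w = 0) ->
  (forall s t, 0 <= s <= t -> t <= T0 -> \int[P]_(w in hit X u s) (F t w ^+ 2) =
     fine (P (hit X u s)) * \int[P]_w (F t w ^+ 2)) ->
  P.-integrable A (EFin \o (fun w => F (tau w) w)) /\
  \int[P]_(w in A) F (tau w) w = 0.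
Proof.
move=> cF mF iF2 C0 FC F0 F2.
have iF t : 0 <= t <= T0 -> P.-integrable setT (EFin \o F t).
  by move=> tT; apply: sqr_integrable_R => //; [exact: mF|exact: iF2].
have mA := measurable_hit u cX mX T0.
have step n (k : 'I_n.+2) (f : T -> R) : P.-integrable setT (EFin \o f) ->
    \int[P]_(w in hit_step n k) f w = \int[P]_(w in hit X u (k%:R * mesh n)) f w
      - \int[P]_(w in hit X u (k%:R * mesh n - mesh n)) f w.
  move=> intf.
  have sub : hit X u (k%:R * mesh n - mesh n) `<=` hit X u (k%:R * mesh n).
    by apply: hit_le; rewrite gerBl (ltW (mesh_gt0 n)).
  have mh t : measurable (hit X u t) by exact: measurable_hit.
  rewrite -[in RHS](setDUK sub) setUC Rintegral_setU//.
  - by rewrite addrK.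
  - exact: measurable_hit_step.
  - by apply: integrableS intf => //; apply: measurableU => //; exact: measurable_hit_step.
  - by apply/disj_setPS => w [[]].
(* [k h - h] is negative for [k = 0]; the hitting event is then empty and the identities are
   trivial. *)
have low n (k : 'I_n.+2) (Q : R -> Prop) :
    Q (k%:R * mesh n) -> (forall s, s < 0 -> Q s) ->
    (forall s, 0 <= s <= k%:R * mesh n -> Q s) -> Q (k%:R * mesh n - mesh n).
  move=> _ Qn Qp; have [h|h] := leP 0 (k%:R * mesh n - mesh n); last exact: Qn.
  by apply: Qp; rewrite h gerBl (ltW (mesh_gt0 n)).
have F0' n (k : 'I_n.+2) : \int[P]_(w in hit_step n k) F (k%:R * mesh n) w = 0.
  have /andP[k0 kT] := mesh_itv k.
  rewrite step; last exact/iF/mesh_itv.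
  rewrite F0 ?k0 ?lexx// sub0r; apply/eqP; rewrite oppr_eq0; apply/eqP.
  apply: (low n k (fun s => \int[P]_(w in hit X u s) F (k%:R * mesh n) w = 0)).
  - by rewrite F0 ?k0 ?lexx.
  - by move=> s s0; rewrite hit_neg// Rintegral_set0.
  - by move=> s sk; exact: F0.
have F2' n (k : 'I_n.+2) : \int[P]_(w in hit_step n k) (F (k%:R * mesh n) w ^+ 2) =
    (\int[P]_(w in hit_step n k) 1) * \int[P]_w (F (k%:R * mesh n) w ^+ 2).
  have /andP[k0 kT] := mesh_itv k.
  have cst1 s : \int[P]_(w in hit X u s) 1 = fine (P (hit X u s)).
    by rewrite Rintegral_cst ?mul1r//; exact: measurable_hit.
  rewrite step; last exact/iF2/mesh_itv.
  rewrite step; last exact: (finite_measure_integrable_cst P 1 measurableT).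
  rewrite mulrBl; congr (_ - _); first by rewrite cst1 F2 ?k0 ?lexx.
  apply: (low n k (fun s => \int[P]_(w in hit X u s) (F (k%:R * mesh n) w ^+ 2) =
    (\int[P]_(w in hit X u s) 1) * \int[P]_w (F (k%:R * mesh n) w ^+ 2))).
  - by rewrite cst1 F2 ?k0 ?lexx.
  - by move=> s s0; rewrite hit_neg// !Rintegral_set0 mul0r.
  - by move=> s sk; rewrite cst1 F2.
(* The steps partition [A]: the discretization of the constant 1 equals 1 on [A]. *)
have sum1 n : \sum_(k < n.+2) \int[P]_(w in hit_step n k) 1 <= 1.
  have [_ <-] := @Rintegral_disc n (fun _ => cst 1)
    (fun _ _ => finite_measure_integrable_cst P 1 measurableT).
  rewrite (_ : \int[P]_(w in A) disc n _ w = \int[P]_(w in A) 1).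
    rewrite Rintegral_cst// mul1r -lee_fin fineK ?fin_num_measure//.
    exact: probability_le1.
  apply: eq_Rintegral => w; rewrite inE => Aw.
  by have [t [_ _ ->]] := disc_ex n Aw.
have disc2 n : (\int[P]_(w in A) (disc n F w ^+ 2)%:E <= C%:E)%E.
  have [i2 e2] := @Rintegral_disc n (fun t w => F t w ^+ 2) iF2.
  rewrite (_ : (\int[P]_(w in A) _)%E =
      (\int[P]_(w in A) (disc n (fun t w => F t w ^+ 2) w)%:E)%E); last first.
    apply: eq_integral => w; rewrite inE => Aw.
    by have [t [_ _ E]] := disc_ex n Aw; rewrite !E.
  rewrite -[X in (X <= _)%E]fineK; last exact: integrable_fin_num.
  rewrite lee_fin -[X in X <= _]/(\int[P]_(w in A) _) e2.
  under eq_bigr do rewrite F2'.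
  apply: (@le_trans _ _ (\sum_(k < n.+2) (\int[P]_(w in hit_step n k) 1) * C)).
    apply: ler_sum => k _; apply: ler_wpM2l; last by apply: FC; exact: mesh_itv.
    by apply: Rintegral_ge0.
  by rewrite -mulr_suml ler_piMl.
have := @L2_bounded_cvg _ _ _ P A (fun n => disc n F) (fun w => F (tau w) w) C mA.
move=> /(_ (fun n => measurable_funTS (measurable_disc n mF)) (measurable_stopped cF mF)
  (fun w Aw => cvg_disc cF Aw) C0 disc2)[iFt H]; split => //.
rewrite -(cvg_lim _ H)//.
rewrite (_ : (fun n => _) = (fun=> 0)); first exact: lim_cst.
apply/funext => n; rewrite (Rintegral_disc n iF).2 big1//.
Qed.

End stopping.

(** * Orthogonality from an even law *)

Section orthogonality.
Context {d : measure_display} {T : measurableType d} {R : realType}.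
Variable P : probability T R.
Variables X W : T -> R.
Hypotheses (mX : measurable_fun setT X) (iX : P.-integrable setT (EFin \o X)).
Hypotheses (mW : measurable_fun setT W) (iW : P.-integrable setT (EFin \o W)).
Hypothesis even_law : forall e A, measurable A ->
  P ((fun w => X w + e * W w) @^-1` A) = P ((fun w => X w - e * W w) @^-1` A).
Hypothesis X_atomless : forall c, P (X @^-1` [set c]) = 0%E.

Let iXW e : P.-integrable setT (EFin \o (fun w => X w + e * W w)).
Proof. by have := integrableD measurableT iX (integrableZl measurableT e iW). Qed.

Let mXW e : measurable_fun setT (fun w => X w + e * W w).
Proof. by apply: measurable_funD => //; exact: measurable_funM. Qed.

(* E[min(X + eW, c)] is even in e, so its derivative at 0 vanishes. *)
Let ray_orthogonal (c : R) : \int[P]_(w in X @^-1` `]-oo, c[) W w = 0.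
Proof.
have mr : measurable (X @^-1` `]-oo, c[) by exact: measurable_preimage.
pose m e w := Num.min (X w + e * W w) c.
have mm e : measurable_fun setT (m e) by apply: measurable_minr => //; exact: mXW.
have im e : P.-integrable setT (EFin \o m e).
  apply: (@dominated_integrable_R _ _ _ P setT _ (fun w => `|X w + e * W w| + `|c|)) => //.
    move=> w _; rewrite /m; have [_|_] := leP (X w + e * W w) c.
      by rewrite lerDl.
    by rewrite lerDr.
  have := integrableD measurableT (integrable_norm (iXW e))
    (finite_measure_integrable_cst P `|c| measurableT).
  by [].
have meq e : \int[P]_w m e w = \int[P]_w m (- e) w.
  have mf : measurable_fun setT (fun x : R => Num.min x c) by exact: measurable_minr.
  rewrite /m (@eq_law_Rintegral _ _ _ _ _ P (fun w => X w + e * W w)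
    (fun w => X w - e * W w) (fun x => Num.min x c))//.
  - by under eq_Rintegral do rewrite -mulNr.
  - by under eq_fun do rewrite -mulNr; exact: mXW.
  - by move=> A mA; exact: even_law.
pose e_ (n : nat) : R := n.+1%:R^-1.
have e0 n : 0 < e_ n by rewrite invr_gt0.
pose q n w := (m (e_ n) w - m (- e_ n) w) / (2 * e_ n).
have iq n : P.-integrable setT (EFin \o (fun w => m (e_ n) w - m (- e_ n) w)).
  by have := integrableB measurableT (im (e_ n)) (im (- e_ n)).
have q0 n : \int[P]_w q n w = 0.
  by rewrite /q RintegralZr// RintegralB// meq subrr mul0r.
(* [x -> min(x, c)] is 1-Lipschitz, so the symmetric difference quotient [q] is dominated by
   [|W|]. *)
have qW n w : `|q n w| <= `|W w|.
  rewrite /q normrM normfV [`|2 * e_ n|]gtr0_norm ?mulr_gt0// ler_pdivrMr ?mulr_gt0//.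
  have -> : `|W w| * (2 * e_ n) = `|e_ n * W w - (- e_ n * W w)|.
    transitivity `|2 * e_ n * W w|; last by congr `|_|; ring.
    by rewrite normrM [`|2 * e_ n|]gtr0_norm ?mulr_gt0// mulrC.
  rewrite /m; move: (e_ n * W w) (- e_ n * W w) => a b.
  have [h1|h1] := leP (X w + a) c; have [h2|h2] := leP (X w + b) c.
  - by rewrite opprD addrACA subrr add0r.
  - by rewrite !ler0_norm; lra.
  - by rewrite !ger0_norm; lra.
  - by rewrite subrr normr0.
have mq n : measurable_fun setT (q n).
  by apply: measurable_funM => //; exact: measurable_funB.
have mWr : measurable_fun setT (W \_ (X @^-1` `]-oo, c[)).
  by apply/(measurable_restrictT _ mr); exact: measurable_funTS.
have ecvg : e_ @ \oo --> (0 : R) by exact: cvg_harmonic.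
have ev (x a b : R) : x < a -> \forall n \near \oo, x + e_ n * b < a.
  move=> xa.
  have : (fun n => x + e_ n * b) @ \oo --> x.
    rewrite -[X in _ --> X]addr0 -[X in _ --> _ + X](mul0r b).
    by apply: cvgD; [exact: cvg_cst|exact: cvgMr_tmp].
  move/cvgrPdist_lt => /(_ (a - x)); rewrite subr_gt0 => /(_ xa).
  by apply: filterS => n; rewrite distrC addrAC subrr add0r ltr_norml => /andP[]; lra.
(* Off [X = c] the quotient is eventually constant: [W] where [X < c], and 0 where [X > c]. The
   remaining event is null by [X_atomless]. *)
have qcvg w : X w <> c -> q ^~ w @ \oo --> (W \_ (X @^-1` `]-oo, c[)) w.
  move=> Xc; have [Xc'|Xc'] := ltP (X w) c.
    apply: cvg_near_cst; rewrite patchE mem_set/=; last by rewrite in_itv.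
    have h1 := ev _ _ (W w) Xc'; have h2 := ev _ _ (- W w) Xc'.
    apply: filterS2 h1 h2 => n h1 h2; rewrite /q /m.
    rewrite min_l ?ltW// min_l ?ltW//; last by rewrite mulNr -mulrN.
    by field; rewrite gt_eqF.
  have {}Xc' : c < X w by rewrite lt_neqAle Xc' andbT eq_sym; apply/eqP.
  apply: cvg_near_cst; rewrite patchE memNset/=; last first.
    by rewrite in_itv/=; apply/negP; rewrite -leNgt ltW.
  have Xc'' : - X w < - c by rewrite ltrN2.
  have h1 := ev _ _ (W w) Xc''; have h2 := ev _ _ (- W w) Xc''.
  apply: filterS2 h1 h2 => n h1 h2; rewrite /q /m.
  rewrite min_r; last by rewrite mulrN in h2; lra.
  rewrite min_r; last by lra.
  by rewrite subrr mul0r.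
have aeq : {ae P, forall w, setT w -> q ^~ w @ \oo --> (W \_ (X @^-1` `]-oo, c[)) w}.
  exists (X @^-1` [set c]); split.
  - exact: measurable_preimage.
  - exact: X_atomless.
  - by move=> w /= nq; apply: contrapT => Xc; apply: nq => _; exact: qcvg.
have [_ H] := Rintegral_dominated_cvg measurableT mq mWr (integrable_norm iW) aeq
  (fun n w _ => qW n w).
rewrite Rintegral_mkcond -(cvg_lim _ H)//.
by under eq_fun do rewrite q0; exact: lim_cst.
Qed.

Hypothesis W0 : \int[P]_w W w = 0.

(** Open rays are stable under intersection and generate the Borel sets, so the pi-lambda theorem
    extends the case of rays. *)
Lemma even_law_orthogonal (A : set R) : measurable A ->
  \int[P]_(w in X @^-1` A) W w = 0.
Proof.
move=> mA.
pose G : set (set T) := [set X @^-1` `]-oo, c[ | c in [set: R]].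
have : <<s G >> `<=` null_class P W.
  apply: lambda_system_subset => //; last 2 first.
  - exact: null_class_lambda_system.
  - move=> _ [c _ <-]; split; last exact: ray_orthogonal.
    exact: measurable_preimage.
  move=> _ _ [c1 _ <-] [c2 _ <-]; exists (Num.min c1 c2) => //.
  by apply/seteqP; split => w /=; rewrite !in_itv/= lt_min => /andP.
move=> /(_ (X @^-1` A))[]//.
pose T' := g_sigma_algebraType G.
suff : measurable_fun (setT : set T') X.
  by move=> /(_ measurableT A mA); rewrite setTI.
apply: (measurability _ (RGenInftyO.measurableE R)) => _ [_ [c ->] <-].
rewrite setTI; apply: sub_sigma_algebra; exists c => //.
Qed.

End orthogonality.

(** * Brownian increments *)

Section brownian.
Context {dO : measure_display} {Omega : measurableType dO} {R : realType}.
Variable P : probability Omega R.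
Variables (d : nat) (B : 'I_d -> R -> {RV P >-> R}) (Sigma : 'M[R]_d).
Hypothesis hB : brownian_motion B Sigma.

Definition increment (s t : R) (w : Omega) : d.-tuple R :=
  [tuple B i t w - B i s w | i < d].

Definition comb (a : 'I_d -> R) (v : d.-tuple R) : R := \sum_(i < d) a i * tnth v i.

(** The variance of [comb a] of an increment over unit time. *)
Definition quad (a : 'I_d -> R) : R := \sum_(i < d) \sum_(j < d) a i * a j * Sigma i j.

Lemma combE a s t w : comb a (increment s t w) = \sum_(i < d) a i * (B i t w - B i s w).
Proof. by apply: eq_bigr => i _; rewrite tnth_mktuple. Qed.

Lemma measurable_B i t : measurable_fun setT (B i t : Omega -> R).
Proof. exact: measurable_funPT. Qed.

Lemma measurable_increment s t : measurable_fun setT (increment s t).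
Proof.
apply/measurable_fun_tnthP => i.
rewrite (_ : _ \o _ = (fun w => B i t w - B i s w)); last first.
  by apply/funext => w /=; rewrite tnth_mktuple.
by apply: measurable_funB; exact: measurable_B.
Qed.

Lemma measurable_comb a : measurable_fun setT (comb a).
Proof.
apply: measurable_sum => i; apply: measurable_funM => //.
exact: measurable_tnth.
Qed.

Lemma measurable_comb_increment a s t :
  measurable_fun setT (fun w => comb a (increment s t w)).
Proof. exact: measurableT_comp (measurable_comb a) (measurable_increment s t). Qed.

Lemma comb_law a s t A : 0 <= s -> s < t -> measurable A ->
  P ((fun w => comb a (increment s t w)) @^-1` A) = normal_law 0 ((t - s) * quad a) A.
Proof.
move=> s0 st mA; have [+ _] := bm_increment hB s0 st.
move=> /(_ a A mA); rewrite (_ : (fun w => _) = (fun w => comb a (increment s t w))).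
  move=> ->; congr (normal_law _ _ _).
  rewrite /quad mulr_sumr; apply: eq_bigr => i _; rewrite mulr_sumr.
  by apply: eq_bigr => j _; rewrite mxE; ring.
by apply/funext => w; rewrite combE.
Qed.

Lemma increment_sqr i s t : 0 <= s -> s <= t ->
  P.-integrable setT (EFin \o (fun w => ((B i t w - B i s w) ^+ 2)%R)) /\
  \int[P]_w ((B i t w - B i s w) ^+ 2) = (t - s) * Sigma i i.
Proof.
move=> s0; rewrite le_eqVlt => /orP[/eqP <-|st].
  rewrite subrr mul0r; split.
    by under eq_fun do rewrite subrr expr0n; exact: finite_measure_integrable_cst.
  by under eq_Rintegral do rewrite subrr expr0n; rewrite Rintegral_cst// mul0r.
have [_ /(_ i i)] := bm_increment hB s0 st.
rewrite unlock mxE => H.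
have mI : measurable_fun setT (fun w => (B i t w - B i s w) ^+ 2).
  by apply: measurable_funX; apply: measurable_funB; exact: measurable_B.
have {}H : (\int[P]_w ((B i t w - B i s w) ^+ 2)%:E = ((t - s) * Sigma i i)%:E)%E.
  by rewrite -H; apply: eq_integral => w _; rewrite expr2.
split; last by rewrite /Rintegral H.
apply/integrableP; split; first exact/measurable_EFinP.
rewrite (_ : (\int[P]_w _)%E = (\int[P]_w ((B i t w - B i s w) ^+ 2)%:E)%E).
  by rewrite H ltry.
by apply: eq_integral => w _; rewrite /= ger0_norm ?sqr_ge0.
Qed.

Lemma integrable_increment i s t : 0 <= s -> s <= t ->
  P.-integrable setT (EFin \o (fun w => B i t w - B i s w)).
Proof.
move=> s0 st; apply: sqr_integrable_R => //; last by have [] := increment_sqr i s0 st.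
by apply: measurable_funB; exact: measurable_B.
Qed.

Lemma integrable_comb a s t : 0 <= s -> s <= t ->
  P.-integrable setT (EFin \o (fun w => comb a (increment s t w))).
Proof.
move=> s0 st.
rewrite (_ : EFin \o _ = (fun w =>
    \sum_(i < d) (a i)%:E * (B i t w - B i s w)%:E)%E); last first.
  by apply/funext => w /=; rewrite combE -sumEFin; apply: eq_bigr => i _; rewrite EFinM.
apply: integrable_sum => // i _; apply: integrableZl => //.
exact: integrable_increment.
Qed.

(** [a] and [- a] give the same variance, hence the same law, so the mean equals its opposite. *)
Lemma comb_mean0 a s t : 0 <= s -> s <= t ->
  \int[P]_w comb a (increment s t w) = 0.
Proof.
move=> s0; rewrite le_eqVlt => /orP[/eqP <-|st].
  rewrite (_ : (fun w => _) = cst 0) ?Rintegral_cst ?mul0r//.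
  by apply/funext => w; rewrite combE big1// => i _; rewrite subrr mulr0.
pose na i := - a i.
have combN v : comb na v = - comb a v.
  by rewrite /comb -sumrN; apply: eq_bigr => i _; rewrite mulNr.
have H : \int[P]_w comb a (increment s t w) = \int[P]_w comb na (increment s t w).
  apply: (@eq_law_Rintegral _ _ _ _ _ P (fun w => comb a (increment s t w))
    (fun w => comb na (increment s t w)) id) => //.
  - exact: measurable_comb_increment.
  - exact: measurable_comb_increment.
  - move=> A mA; rewrite (comb_law a s0 st mA) (comb_law na s0 st mA).
    have -> // : quad na = quad a.
    by apply: eq_bigr => i _; apply: eq_bigr => j _; rewrite /na mulrNN.
have : \int[P]_w comb na (increment s t w) = - \int[P]_w comb a (increment s t w).
  under eq_Rintegral do rewrite combN -mulN1r.
  by rewrite RintegralZl ?mulN1r//; apply: integrable_comb => //; exact: ltW.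
by lra.
Qed.

Definition other_boxes (n : nat) (t : nat -> R) (j : 'I_n) (A : nat -> set (d.-tuple R))
  : set Omega := [set w | forall k : 'I_n, k != j -> A k (increment (t k) (t k.+1) w)].

Lemma other_boxesE n t j A : @other_boxes n t j A =
  \bigcap_(k in [set: 'I_n]) ((fun w => increment (t k) (t k.+1) w) @^-1`
    (if k == j then setT else A k)).
Proof.
apply/seteqP; split => [w H k _ /=|w H k kj].
  by case: ifPn => // kj; exact: H.
by have := H k I; rewrite /= (negbTE kj).
Qed.

Lemma measurable_other_boxes n t j A : (forall k, measurable (A k)) ->
  measurable (@other_boxes n t j A).
Proof.
move=> mA; rewrite other_boxesE; apply: fin_bigcap_measurable => //.
move=> k _; apply: measurable_preimage; first exact: measurable_increment.
by case: ifP.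
Qed.

(** The product rule with the whole space in slot [j] gives the probability of the event, and with a
    set [C] in that slot the joint probability; comparing them shows that the event is independent
    of the [j]-th increment. *)
Lemma Rintegral_other_boxes (n : nat) (t : nat -> R) (j : 'I_n)
    (A : nat -> set (d.-tuple R)) (f : d.-tuple R -> R) :
  0 <= t 0%N -> (forall k, (k < n)%N -> t k < t k.+1) ->
  (forall k, measurable (A k)) -> measurable_fun setT f ->
  P.-integrable setT (EFin \o (fun w => f (increment (t j) (t j.+1) w))) ->
  \int[P]_(w in other_boxes t j A) f (increment (t j) (t j.+1) w) =
  fine (P (other_boxes t j A)) * \int[P]_w f (increment (t j) (t j.+1) w).
Proof.
move=> t0 tk mA mf intf.
apply: (@indep_Rintegral _ _ _ _ _ P _ (increment (t j) (t j.+1))) => //.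
- exact: measurable_other_boxes.
- exact: measurable_increment.
move=> C mC.
have ind := bm_independent hB t0 tk.
have E1 : P (other_boxes t j A) =
    (\prod_(k < n | k != j) P (increment (t k) (t k.+1) @^-1` A k))%E.
  rewrite other_boxesE ind; last by move=> k; case: ifP.
  rewrite (bigD1 j)//= eqxx preimage_setT probability_setT mul1e.
  by apply: eq_bigr => k kj; rewrite (negbTE kj).
have -> : other_boxes t j A `&` increment (t j) (t j.+1) @^-1` C =
    \bigcap_(k in [set: 'I_n]) ((fun w => increment (t k) (t k.+1) w) @^-1`
      (if k == j then C else A k)).
  apply/seteqP; split => [w [H HC] k _ /=|w H].
    by case: eqVneq => [->//|kj]; exact: H.
  split => [k kj|]; first by have := H k I; rewrite /= (negbTE kj).
  by have := H j I; rewrite /= eqxx.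
rewrite ind; last by move=> k; case: ifP.
rewrite (bigD1 j)//= eqxx E1 muleC; congr (_ * _)%E.
by apply: eq_bigr => k kj; rewrite (negbTE kj).
Qed.

End brownian.

(** * Hitting events of the sum in terms of increments *)

Section brownian_hitting.
Context {dO : measure_display} {Omega : measurableType dO} {R : realType}.
Variable P : probability Omega R.
Variables (d : nat) (B : 'I_d -> R -> {RV P >-> R}) (Sigma : 'M[R]_d).
Hypothesis hB : brownian_motion B Sigma.
Variables (r_ : 'I_d -> R) (u : R).
Hypothesis u0 : 0 < u.

Local Notation r := (\sum_(i < d) r_ i).
Definition risk (i : 'I_d) (t : R) (w : Omega) : R := r_ i * t + B i t w.
Local Notation S := (aggregate risk).
Definition ones (i : 'I_d) : R := 1.
Local Notation X_ s t w := (comb ones (increment B s t w)).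

Lemma aggregateE t w : S t w = r * t + \sum_(i < d) B i t w.
Proof. by rewrite /aggregate /risk big_split/= -mulr_suml. Qed.

Lemma comb_onesE s t w : X_ s t w = \sum_(i < d) B i t w - \sum_(i < d) B i s w.
Proof. by rewrite combE -sumrB; apply: eq_bigr => i _; rewrite mul1r. Qed.

Lemma continuous_risk i : continuous_paths (risk i).
Proof.
move=> w x; apply: cvgD; last exact: (bm_continuous hB).
by apply: cvgMl_tmp; apply: continuous_subspaceT => y; exact: cvg_id.
Qed.

Lemma continuous_aggregate : continuous_paths S.
Proof.
move=> w; apply: continuous_big; last by move=> i _; exact: continuous_risk.
exact: add_continuous.
Qed.

Lemma measurable_risk i t : measurable_fun setT (risk i t).
Proof. by apply: measurable_funD => //; exact: measurable_B. Qed.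

Lemma measurable_aggregate t : measurable_fun setT (S t).
Proof. by apply: measurable_sum => i; exact: measurable_risk. Qed.

Lemma start_null : exists N : set Omega, [/\ measurable N, P N = 0%E &
  forall w, ~ N w -> forall i, B i 0 w = 0].
Proof.
have [N [mN N0 H]] := bm_start hB; exists N; split => // w nw.
by apply: contrapT => nB; apply: nw; exact: H.
Qed.

(** As [u > 0], the level is reached at time 0 only on the null set where [B] does not start at
    0. *)
Lemma null_class_hit0 (Z : Omega -> R) : P.-integrable setT (EFin \o Z) ->
  null_class P Z (hit S u 0).
Proof.
move=> iZ; have [N [mN PN N0]] := start_null.
apply: (@null_class_ae _ _ _ P Z iZ set0 _ N) => //.
- by split => //; rewrite Rintegral_set0.
- by apply: measurable_hit; [exact: continuous_aggregate|exact: measurable_aggregate].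
rewrite set0D; apply/seteqP; split => // w [[s /andP[s0 s0']] us] nw.
have {s0 s0'} s0 : s = 0 by apply/eqP; rewrite eq_le s0 s0'.
move: us; rewrite s0 aggregateE mulr0 add0r big1 ?leNgt ?u0//.
by move=> i _; exact: N0.
Qed.

Lemma comb_telescope (a : 'I_d -> R) (h : R) n w :
  \sum_(k < n) comb a (increment B (k%:R * h) (k.+1%:R * h) w) =
  comb a (increment B 0 (n%:R * h) w).
Proof.
elim: n => [|n IHn].
  by rewrite big_ord0 mul0r combE big1// => i _; rewrite subrr mulr0.
rewrite big_ord_recr/= IHn !combE -big_split/=; apply: eq_bigr => i _.
by rewrite -mulrDr; congr (_ * _); ring.
Qed.

(** On a dyadic grid the driftless part of [S] is a partial sum of increments of [b], so dyadic hits
    are partial-sum events whose threshold is the lowered level minus the drift, off the null set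
    where [B] does not start at 0. *)
Lemma null_class_hit_boxes (Z : Omega -> R) (T t : R) :
  P.-integrable setT (EFin \o Z) -> \int[P]_w Z w = 0 -> 0 < T -> 0 <= t <= T ->
  (forall n : nat, (0 < n)%N ->
    boxes n (fun k w => X_ (k%:R * (T / n%:R)) (k.+1%:R * (T / n%:R)) w) `<=` null_class P Z) ->
  null_class P Z (hit S u t).
Proof.
move=> iZ Z0 T0 tT HB; have [N [mN PN N0]] := start_null.
apply: (null_class_hit continuous_aggregate iZ Z0 T0 tT) => m j.
have n0 : (0 < 2 ^ j)%N by rewrite expn_gt0.
pose h := T / 2 ^+ j.
have hE : T / (2 ^ j)%N%:R = h by rewrite natrX.
have := @null_class_partial_sums _ _ _ P Z iZ Z0 (2 ^ j)%N _ (fun i => i%:R * h <= t)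
  (fun i => u - m.+1%:R^-1 - r * (i%:R * h)) (HB _ n0).
move=> /(@null_class_ae _ _ _ P Z iZ _ (dyadic_hit S u T t m j) N); apply => //.
  exact: (measurable_dyadic_hit _ measurable_aggregate).
rewrite hE; apply/seteqP; split => w [[i ij Hi] nw].
  have B0 : \sum_(i < d) B i 0 w = 0 by rewrite big1// => k _; exact: N0.
  split => //; exists i => //.
  by move: Hi; rewrite comb_telescope comb_onesE aggregateE B0 subr0 ltrBlDl.
have B0 : \sum_(i < d) B i 0 w = 0 by rewrite big1// => k _; exact: N0.
split => //; exists i => //.
rewrite comb_telescope comb_onesE B0 subr0 ltrBlDl; move: Hi; rewrite aggregateE; exact.
Qed.

(** The boxes concern increments over [[0, t]], which are independent of the increment over
    [[t, T]]: all of them are placed on one grid whose last interval is [[t, T]]. *)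
Lemma null_class_hit_future (s t T : R) (f : d.-tuple R -> R) :
  0 <= s <= t -> t < T -> measurable_fun setT f ->
  P.-integrable setT (EFin \o (fun w => f (increment B t T w))) ->
  \int[P]_w f (increment B t T w) = 0 ->
  null_class P (fun w => f (increment B t T w)) (hit S u s).
Proof.
move=> /andP[s0 st] tT mf intf f0.
(* At [t = 0] there is no grid of positive mesh, but the event is negligible. *)
have [t0|t0] := leP t 0.
  have -> : s = 0 by apply/eqP; rewrite eq_le s0 (le_trans st).
  exact: null_class_hit0.
apply: (null_class_hit_boxes intf f0 t0); first by rewrite s0.
move=> n n0 _ [A mA ->].
have n0' : (0 : R) < n%:R by rewrite ltr0n.
pose h := t / n%:R; have h0 : 0 < h by rewrite divr_gt0.
have nh : n%:R * h = t by rewrite /h mulrC divfK// gt_eqF.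
(* The regular grid of [[0, t]], followed by [T] at index [n + 1]. *)
pose tt (k : nat) : R := if (k <= n)%N then k%:R * h else T.
pose A' k := comb ones @^-1` A k.
have ttn : tt n = t by rewrite /tt leqnn.
have ttn1 : tt n.+1 = T by rewrite /tt ltnn.
have := @Rintegral_other_boxes _ _ _ P d B Sigma hB n.+1 tt ord_max A' f.
rewrite /= ttn ttn1 f0 mulr0 => H.
have boxE : box n (fun k w => X_ (k%:R * h) (k.+1%:R * h) w) A =
    other_boxes B tt (@ord_max n) A'.
  apply/seteqP; split => [w Hw k kn|w Hw k kn].
    have kn' : (k < n)%N.
      by rewrite ltn_neqAle -ltnS ltn_ord andbT; apply: contra kn => /eqP kn; exact/eqP/val_inj.
    by rewrite /A' /tt (ltnW kn') kn'; exact: Hw.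
  have kn1 : (k < n.+1)%N by rewrite (ltn_trans kn).
  have := Hw (Ordinal kn1); rewrite /A' /tt /= (ltnW kn) kn; apply.
  by apply/eqP => /(congr1 val)/= kE; move: kn; rewrite kE ltnn.
split.
  rewrite boxE; apply: measurable_other_boxes => k.
  by apply: measurable_preimage => //; exact: measurable_comb.
rewrite boxE; apply: H => //.
- by rewrite /tt mul0r.
- move=> k; rewrite ltnS leq_eqVlt => /orP[/eqP->|kn]; first by rewrite ttn ttn1.
  by rewrite /tt (ltnW kn) kn ltr_pM2r// ltr_nat.
- by move=> k; apply: measurable_preimage => //; exact: measurable_comb.
Qed.

(** The event runs up to [T], so no increment lies in its future. Instead the combination is split
    along the grid: over a box, the conditions on the other intervals factor out by independence,
    and the remaining factor vanishes by orthogonality on one interval. *)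
Lemma null_class_hit_orthogonal (a : 'I_d -> R) (T : R) : 0 < T ->
  (forall s t A, 0 <= s -> s < t -> measurable A ->
    \int[P]_(w in (fun w => X_ s t w) @^-1` A) comb a (increment B s t w) = 0) ->
  null_class P (fun w => comb a (increment B 0 T w)) (hit S u T).
Proof.
move=> T0 orth.
have iZ := integrable_comb hB a (lexx 0) (ltW T0).
have Z0 := comb_mean0 hB a (lexx 0) (ltW T0).
apply: (null_class_hit_boxes iZ Z0 T0); first by rewrite lexx ltW.
move=> n n0 _ [A mA ->].
have n0' : (0 : R) < n%:R by rewrite ltr0n.
pose h := T / n%:R; have h0 : 0 < h by rewrite divr_gt0.
have nh : n%:R * h = T by rewrite /h mulrC divfK// gt_eqF.
pose tt (k : nat) : R := k%:R * h.
have tt0 (k : nat) : 0 <= tt k by rewrite mulr_ge0// ltW.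
have ttS k : tt k < tt k.+1 by rewrite ltr_pM2r// ltr_nat.
pose A' k := comb ones @^-1` A k.
have mA' k : measurable (A' k).
  by apply: measurable_preimage => //; exact: measurable_comb.
have boxE (j : 'I_n) : box n (fun k w => X_ (tt k) (tt k.+1) w) A =
    other_boxes B tt j A' `&` increment B (tt j) (tt j.+1) @^-1` A' j.
  apply/seteqP; split => [w Hw|w [Hw Hj] k kn]; first by split => [k kj|]; exact: Hw.
  have [jk|kj] := eqVneq (Ordinal kn) j; first by move: Hj; rewrite -jk.
  by have := Hw (Ordinal kn) kj.
have mbox : measurable (box n (fun k w => X_ (tt k) (tt k.+1) w) A).
  rewrite (boxE (Ordinal n0)); apply: measurableI; first exact: measurable_other_boxes.
  by apply: measurable_preimage => //; exact: measurable_increment.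
split => //.
have step (j : 'I_n) : \int[P]_(w in box n (fun k w => X_ (tt k) (tt k.+1) w) A)
    comb a (increment B (tt j) (tt j.+1) w) = 0.
  (* The condition on the [j]-th increment moves into the integrand, so that the event left over
     concerns the other increments only. *)
  pose f v := comb a v * \1_(A' j) v.
  have fE : (fun w => comb a (increment B (tt j) (tt j.+1) w))
      \_ (increment B (tt j) (tt j.+1) @^-1` A' j) =
      (fun w => f (increment B (tt j) (tt j.+1) w)).
    apply/funext => w; rewrite patchE /f indicE.
    have -> : (w \in increment B (tt j) (tt j.+1) @^-1` A' j) =
        (increment B (tt j) (tt j.+1) w \in A' j) by apply/idP/idP; rewrite !inE.
    by case: ifP; rewrite ?mulr1 ?mulr0.
  have mf : measurable_fun setT f.
    by apply: measurable_funM; [exact: measurable_comb|exact: measurable_indic].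
  have intf : P.-integrable setT (EFin \o (fun w => f (increment B (tt j) (tt j.+1) w))).
    have ic := integrable_comb hB a (tt0 j) (ltW (ttS j)).
    apply: (dominated_integrable_R measurableT _ _ (integrable_norm ic)).
      exact: measurableT_comp mf (measurable_increment _ _ _).
    move=> w _; rewrite /= /f normrM indicE; case: (_ \in _); rewrite ?normr1 ?mulr1//.
    by rewrite normr0 mulr0.
  rewrite (boxE j) Rintegral_mkcondr fE.
  rewrite (Rintegral_other_boxes hB)//.
  rewrite -fE -Rintegral_mkcond.
  have -> : increment B (tt j) (tt j.+1) @^-1` A' j =
    (fun w => X_ (tt j) (tt j.+1) w) @^-1` A j by [].
  by rewrite orth ?mulr0.
rewrite /Rintegral.
rewrite (_ : (\int[P]_(w in _) _)%E = (\int[P]_(w in box n (fun k w => X_ (tt k) (tt k.+1) w) A)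
    (\sum_(j < n) (comb a (increment B (tt j) (tt j.+1) w))%:E))%E); last first.
  apply: eq_integral => w _; rewrite sumEFin comb_telescope nh.
  by [].
rewrite integral_sum//; last first.
  move=> j; apply: integrableS (integrable_comb hB a (tt0 j) (ltW (ttS j))) => //.
rewrite big1// => j _.
have := step j; rewrite /Rintegral => /eqP; rewrite fine_eq0; first by move=> /eqP.
apply: integrable_fin_num => //.
by apply: integrableS (integrable_comb hB a (tt0 j) (ltW (ttS j))).
Qed.

(** The double sum assumed to vanish is the coefficient of [e] in the variance of [b + e W] per unit
    time, with [W] the combination by [a]. The variance, and so the centered Gaussian law, is then
    even in [e]; positive total variance excludes atoms of [b]. *)
Lemma comb_orthogonal (a : 'I_d -> R) :
  0 < \sum_(i < d) \sum_(j < d) Sigma i j ->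
  \sum_(i < d) \sum_(j < d) (a i + a j) * Sigma i j = 0 ->
  forall s t A, 0 <= s -> s < t -> measurable A ->
  \int[P]_(w in (fun w => X_ s t w) @^-1` A) comb a (increment B s t w) = 0.
Proof.
move=> sig0 cross s t A s0 st mA.
have q1 : quad Sigma ones = \sum_(i < d) \sum_(j < d) Sigma i j.
  by apply: eq_bigr => i _; apply: eq_bigr => j _; rewrite !mul1r.
have combD e v : comb (fun i => ones i + e * a i) v = comb ones v + e * comb a v.
  rewrite /comb mulr_sumr -big_split/=; apply: eq_bigr => i _; ring.
have quadD e : quad Sigma (fun i => ones i + e * a i) =
    quad Sigma ones + e ^+ 2 * quad Sigma a.
  transitivity (quad Sigma ones +
      e * (\sum_(i < d) \sum_(j < d) (a i + a j) * Sigma i j) + e ^+ 2 * quad Sigma a).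
    rewrite /quad !mulr_sumr -!big_split/=; apply: eq_bigr => i _.
    rewrite !mulr_sumr -!big_split/=; apply: eq_bigr => j _; rewrite /ones; ring.
  by rewrite cross mulr0 addr0.
apply: (even_law_orthogonal (measurable_comb_increment B ones s t)
  (integrable_comb hB ones s0 (ltW st)) (measurable_comb_increment B a s t)
  (integrable_comb hB a s0 (ltW st)) _ _ (comb_mean0 hB a s0 (ltW st))) => //.
- move=> e C mC.
  have H e' : (fun w => X_ s t w + e' * comb a (increment B s t w)) =
      (fun w => comb (fun i => ones i + e' * a i) (increment B s t w)).
    by apply/funext => w; rewrite combD.
  have -> : (fun w => X_ s t w - e * comb a (increment B s t w)) =
      (fun w => X_ s t w + (- e) * comb a (increment B s t w)).
    by apply/funext => w; rewrite mulNr.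
  rewrite (H e) (H (- e)).
  rewrite (comb_law hB (fun i => ones i + e * a i) s0 st mC).
  rewrite (comb_law hB (fun i => ones i + - e * a i) s0 st mC).
  by rewrite (quadD e) (quadD (- e)) sqrrN.
- move=> c; rewrite (comb_law hB ones s0 st (measurable_set1 c)) q1 /normal_law.
  by rewrite mulf_eq0 subr_eq0 (gt_eqF st) (gt_eqF sig0) /normal_prob integral_set1.
Qed.

Lemma covariance_sym i j : Sigma i j = Sigma j i.
Proof.
have [_ H] := bm_increment hB (lexx 0) ltr01.
have := H i j; have := H j i; rewrite !mxE subr0 !mul1r.
rewrite (_ : (fun w => (B j 1 w - B j 0 w) * (B i 1 w - B i 0 w)) =
   (fun w => (B i 1 w - B i 0 w) * (B j 1 w - B j 0 w))).
  by move=> -> -[].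
by apply/funext => w; rewrite mulrC.
Qed.

End brownian_hitting.

(** * The components at the ruin time *)

Section stopped_brownian.
Context {dO : measure_display} {Omega : measurableType dO} {R : realType}.
Variable P : probability Omega R.
Variables (d : nat) (B : 'I_d -> R -> {RV P >-> R}) (Sigma : 'M[R]_d).
Hypothesis hB : brownian_motion B Sigma.
Variables (r_ : 'I_d -> R) (u T : R).
Hypotheses (u0 : 0 < u) (T0 : 0 < T).

Local Notation r := (\sum_(i < d) r_ i).
Local Notation S := (aggregate (risk B r_)).
Local Notation A := (hit S u T).
Local Notation tau := (fun w => fine (ruin_time S u w)).

Let cS : continuous_paths S := @continuous_aggregate _ _ _ P d B Sigma hB r_.
Let mS : forall t, measurable_fun setT (S t) := @measurable_aggregate _ _ _ P d B r_.
Let mA : measurable A := measurable_hit u cS mS T.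

Lemma start_integrable i E : measurable E ->
  P.-integrable E (EFin \o B i 0) /\ \int[P]_(w in E) B i 0 w = 0.
Proof.
move=> mE; have [N [mN PN N0]] := start_null hB.
have H : ae_eq P E (EFin \o cst 0) (EFin \o B i 0).
  exists N; split => // w /= nw; apply: contrapT => Nw; apply: nw => _.
  by rewrite N0.
have mB : measurable_fun E (EFin \o B i 0).
  by apply/measurable_EFinP/measurable_funTS; exact: measurable_B.
have mc : measurable_fun E (EFin \o cst 0 : Omega -> \bar R).
  by apply/measurable_EFinP; exact: measurable_cst.
split; last first.
  have := @ae_eq_integral _ _ _ P E (EFin \o B i 0) (EFin \o cst 0) mE mc mB H.
  by rewrite /Rintegral /comp => <-; rewrite integral0.
apply/integrableP; split => //.
have := @ae_eq_integral _ _ _ P E (abse \o (EFin \o B i 0)) (abse \o (EFin \o cst 0)) mE.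
rewrite /comp => <-.
- by under eq_integral do rewrite /= normr0; rewrite integral0.
- by apply: measurableT_comp => //; exact: mc.
- exact: measurableT_comp.
- exact: ae_eq_abse H.
Qed.

Lemma integrable_B i t E : measurable E -> 0 <= t -> P.-integrable E (EFin \o B i t).
Proof.
move=> mE t0.
have h1 := (start_integrable i mE).1.
have h2 : P.-integrable E (EFin \o (fun w => B i t w - B i 0 w)).
  by apply: integrableS (integrable_increment hB i (lexx 0) t0).
have := integrableD mE h2 h1; apply: eq_integrable => // w _ /=.
by rewrite -EFinD subrK.
Qed.

Lemma seq_continuous_path (f : R -> Omega -> R) : continuous_paths f ->
  seq_continuous T f.
Proof.
move=> cf w s t_ /andP[s0 _] tn ts.
apply: (within_continuous_cvg (@cf w) s0 _ ts) => n.
by have /andP[] := tn n.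
Qed.

Lemma continuous_B i : continuous_paths (fun t w => B i t w).
Proof. exact: (bm_continuous hB). Qed.

(** Subtracting the mean of the integrand reduces this to the centered case
    [null_class_hit_future]. *)
Lemma future_hit (s t : R) (f : d.-tuple R -> R) :
  0 <= s <= t -> t < T -> measurable_fun setT f ->
  P.-integrable setT (EFin \o (fun w => f (increment B t T w))) ->
  \int[P]_(w in hit S u s) f (increment B t T w) =
  fine (P (hit S u s)) * \int[P]_w f (increment B t T w).
Proof.
move=> st tT mf intf; set c := \int[P]_w _.
have mh : measurable (hit S u s) by exact: measurable_hit.
pose g v := f v - c.
have ic E : measurable E -> P.-integrable E (EFin \o cst c).
  by move=> mE; exact: finite_measure_integrable_cst.
have intg : P.-integrable setT (EFin \o (fun w => g (increment B t T w))).
  by have := integrableB measurableT intf (ic _ measurableT).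
have g0 : \int[P]_w g (increment B t T w) = 0.
  rewrite /g RintegralB//; last exact: ic.
  rewrite Rintegral_cst//; rewrite [X in fine X]probability_setT mulr1.
  exact: subrr.
have mg : measurable_fun setT g by exact: measurable_funB.
have [_] := null_class_hit_future hB r_ u0 st tT mg intg g0.
rewrite /g RintegralB//; last 2 first.
- by apply: integrableS intf.
- exact: ic.
by rewrite Rintegral_cst// => /eqP; rewrite subr_eq0 mulrC => /eqP.
Qed.

(** Optional stopping for [F t = B i T - B i t], a centered function of the future increment with
    second moment [(T - t) * Sigma i i], at most [T * Sigma i i]. *)
Lemma stopped_component i :
  P.-integrable A (EFin \o (fun w => B i (tau w) w)) /\
  \int[P]_(w in A) B i (tau w) w = \int[P]_(w in A) B i T w.
Proof.
pose F t w := B i T w - B i t w.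
have FE t : F t = (fun w => tnth (increment B t T w) i).
  by apply/funext => w; rewrite tnth_mktuple.
have mi : measurable_fun setT (fun v : d.-tuple R => tnth v i) by exact: measurable_tnth.
have cF : seq_continuous T F.
  move=> w s t_ s0 tn ts; apply: cvgB; first exact: cvg_cst.
  exact: (seq_continuous_path (@continuous_B i) s0 tn ts).
have iF t : 0 <= t <= T -> P.-integrable setT (EFin \o F t).
  by move=> /andP[t0 tT]; exact: (integrable_increment hB i t0 tT).
have iF2 t : 0 <= t <= T -> P.-integrable setT (EFin \o (fun w => (F t w ^+ 2)%R)).
  by move=> /andP[t0 tT]; exact: (increment_sqr hB i t0 tT).1.
have Fzero t : 0 <= t <= T -> \int[P]_w F t w = 0.
  move=> /andP[t0 tT]; rewrite -(comb_mean0 hB (fun k => (k == i)%:R) t0 tT).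
  apply: eq_Rintegral => w _; rewrite combE (bigD1 i)//= eqxx mul1r big1 ?addr0//.
  by move=> k ki; rewrite (negbTE ki) mul0r.
have FT w : F T w = 0 by rewrite /F subrr.
have S0 : 0 <= Sigma i i.
  have [_ H] := increment_sqr hB i (lexx 0) ler01.
  by rewrite -[Sigma i i]mul1r -[X in X * _]subr0 -H; apply: Rintegral_ge0 => w _; exact: sqr_ge0.
have [||||||iFt H] := @stopped_martingale _ _ _ S u cS mS T T0 P F (T * Sigma i i) cF.
- by move=> t _; apply: measurable_funB; exact: measurable_B.
- exact: iF2.
- by rewrite mulr_ge0// ltW.
- move=> t /andP[t0 tT]; rewrite (increment_sqr hB i t0 tT).2 ler_wpM2r//.
  by rewrite gerBl.
- move=> s t st; have /andP[s0 st'] := st; have t0 := le_trans s0 st'.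
  (* [future_hit] needs [t < T]; at [t = T] the increment is zero. *)
  rewrite le_eqVlt => /orP[/eqP ->|tT].
    by under eq_Rintegral do rewrite FT; rewrite Rintegral_cst ?mul0r//; exact: measurable_hit.
  have tT' : 0 <= t <= T by rewrite t0 ltW.
  have := Fzero _ tT'; have := iF _ tT'; rewrite FE => h1 h2.
  by rewrite (future_hit st tT mi)// h2 mulr0.
- move=> s t st; have /andP[s0 st'] := st; have t0 := le_trans s0 st'.
  rewrite le_eqVlt => /orP[/eqP ->|tT].
    under eq_Rintegral do rewrite FT expr0n.
    under [X in _ = _ * X]eq_Rintegral do rewrite FT expr0n.
    by rewrite !Rintegral_cst ?mul0r ?mulr0//; exact: measurable_hit.
  have tT' : 0 <= t <= T by rewrite t0 ltW.
  have := iF2 _ tT'; rewrite FE => h1.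
  by rewrite (@future_hit _ _ (fun v => tnth v i ^+ 2) st tT)//; exact: measurable_funX.
have iBT : P.-integrable A (EFin \o B i T) by apply: integrable_B => //; exact: ltW.
have iBt : P.-integrable A (EFin \o (fun w => B i (tau w) w)).
  have := integrableB mA iBT iFt; apply: eq_integrable => // w _ /=.
  by rewrite -EFinB /F subKr.
split => //; move: H; rewrite /F RintegralB// => /eqP.
by rewrite subr_eq0 => /eqP.
Qed.

Lemma integrable_tau : P.-integrable A (EFin \o tau).
Proof.
apply: (@bounded_integrable_R _ _ _ P A _ T mA).
  (* [tau] is the value at [tau] of the deterministic process [F t w = t]. *)
  apply: (@measurable_stopped _ _ _ S u cS mS T T0 (fun t _ => t)).
    by move=> w s t_ _ _.
  by move=> t _; exact: measurable_cst.
by move=> w /(tau_itv cS T0)/andP[t0 tT]; rewrite ger0_norm.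
Qed.

Lemma aggregate_tau : exists N : set Omega, [/\ measurable N, P N = 0%E,
  forall w, ~ N w -> forall i, B i 0 w = 0 &
  forall w, A w -> ~ N w -> S (tau w) w = u].
Proof.
have [N [mN PN N0]] := start_null hB; exists N; split => // w Aw nw.
apply: (tau_level cS T0) => //.
by rewrite aggregateE mulr0 add0r big1// => i _; exact: N0.
Qed.

Lemma Rintegral_ae (E N : set Omega) (f g : Omega -> R) : measurable E ->
  P.-integrable E (EFin \o f) -> P.-integrable E (EFin \o g) ->
  measurable N -> P N = 0%E -> (forall w, E w -> ~ N w -> f w = g w) ->
  \int[P]_(w in E) f w = \int[P]_(w in E) g w.
Proof.
move=> mE /integrableP[mf _] /integrableP[mg _] mN PN fg; rewrite /Rintegral; congr fine.
apply: (@ae_eq_integral _ _ _ P E (EFin \o g) (EFin \o f) mE mf mg).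
exists N; split => // w /= nw; apply: contrapT => Nw; apply: nw => Ew.
by rewrite fg.
Qed.

Lemma Rintegral_finite_sum (f : 'I_d -> Omega -> R) E : measurable E ->
  (forall i, P.-integrable E (EFin \o f i)) ->
  P.-integrable E (EFin \o (fun w => \sum_(i < d) f i w)) /\
  \int[P]_(w in E) (\sum_(i < d) f i w) = \sum_(i < d) \int[P]_(w in E) f i w.
Proof.
move=> mE fi.
have EFs : EFin \o (fun w => \sum_(i < d) f i w) = (fun w => \sum_(i < d) (f i w)%:E)%E.
  by apply/funext => w /=; rewrite sumEFin.
split; first by rewrite EFs; apply: integrable_sum => // i _; exact: fi.
rewrite /Rintegral (_ : (fun w => (\sum_(i < d) f i w)%:E) =
  (fun w => \sum_(i < d) (f i w)%:E)%E); last by rewrite -EFs.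
rewrite integral_sum// -[RHS]/(fine (\sum_(i < d) \int[P]_(w in E) f i w)%:E) -sumEFin.
congr fine; apply: eq_bigr => i _; rewrite /Rintegral fineK//.
exact: (integrable_fin_num mE (fi i)).
Qed.

(** Off a null set [S] equals [u] at [tau], so the components of [B] add up to [u - r tau] there. *)
Lemma sum_stopped : \sum_(i < d) \int[P]_(w in A) B i (tau w) w =
  u * fine (P A) - r * \int[P]_(w in A) tau w.
Proof.
have [N [mN PN N0 Su]] := aggregate_tau.
have [isum <-] := Rintegral_finite_sum mA (fun i => (stopped_component i).1).
have icu : P.-integrable A (EFin \o cst u) by exact: finite_measure_integrable_cst.
have irt : P.-integrable A (EFin \o (fun w => r * tau w)).
  by have := integrableZl mA r integrable_tau.
rewrite -(@RintegralZl _ _ _ P A tau r mA integrable_tau) -Rintegral_cst// -RintegralB//.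
apply: (@Rintegral_ae A N) => //.
  by have := integrableB mA icu irt.
move=> w Aw nw; have := Su w Aw nw; rewrite aggregateE => h.
by apply/eqP; rewrite eq_sym subr_eq addrC h.
Qed.

Lemma stopped_component_mean (i : 'I_d) : 0 < \sum_(i < d) \sum_(j < d) Sigma i j ->
  \int[P]_(w in A) B i (tau w) w =
  (\sum_(j < d) Sigma i j) / (\sum_(i < d) \sum_(j < d) Sigma i j) *
  (u * fine (P A) - r * \int[P]_(w in A) tau w).
Proof.
move=> sig0; set beta := _ / _.
have iT k : P.-integrable A (EFin \o B k T) by apply: integrable_B => //; exact: ltW.
have i0 k := start_integrable k mA.
rewrite -sum_stopped (stopped_component i).2.
under eq_bigr do rewrite (stopped_component _).2.
(* [comb a] gives [B_i - beta b]; [beta] is the regression coefficient of [B_i] on [b], which makes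
   the covariance with [b] vanish. *)
pose a k : R := (k == i)%:R - beta.
have cross : \sum_(k < d) \sum_(l < d) (a k + a l) * Sigma k l = 0.
  have sumk : \sum_(k < d) \sum_(l < d) a k * Sigma k l = 0.
    transitivity (\sum_(k < d) ((k == i)%:R * \sum_(l < d) Sigma k l
        - beta * \sum_(l < d) Sigma k l)).
      by apply: eq_bigr => k _; rewrite -mulr_sumr mulrBl.
    rewrite sumrB -mulr_sumr /beta divfK ?gt_eqF// (bigD1 i)//= eqxx mul1r.
    rewrite [X in _ + X - _]big1 ?addr0 ?subrr//.
    by move=> k ki; rewrite (negbTE ki) mul0r.
  transitivity (\sum_(k < d) \sum_(l < d) a k * Sigma k l +
      \sum_(k < d) \sum_(l < d) a l * Sigma k l).
    rewrite -big_split/=; apply: eq_bigr => k _.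
    by rewrite -big_split/=; apply: eq_bigr => l _; rewrite mulrDl.
  rewrite [X in _ + X]exchange_big/= sumk add0r -[RHS]sumk.
  by apply: eq_bigr => k _; apply: eq_bigr => l _; rewrite (covariance_sym hB).
have [_] := null_class_hit_orthogonal hB r_ u T0 (comb_orthogonal hB sig0 cross).
have iinc k : P.-integrable A (EFin \o (fun w => a k * (B k T w - B k 0 w))).
  have := integrableZl mA (a k) (integrableB mA (iT k) (i0 k).1).
  by apply: eq_integrable.
under eq_Rintegral do rewrite combE.
rewrite (Rintegral_finite_sum mA iinc).2.
have E k : \int[P]_(w in A) (a k * (B k T w - B k 0 w)) = a k * \int[P]_(w in A) B k T w.
  rewrite RintegralZl//; last by have := integrableB mA (iT k) (i0 k).1.
  by rewrite RintegralB// ?(i0 k).2 ?subr0//; exact: (i0 k).1.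
rewrite (eq_bigr (fun k => a k * \int[P]_(w in A) B k T w)); last by move=> k _; exact: E.
under eq_bigr do rewrite mulrBl.
rewrite sumrB -mulr_sumr (bigD1 i)//= eqxx mul1r big1 ?addr0; last first.
  by move=> k ki; rewrite (negbTE ki) mul0r.
by move=> /eqP; rewrite subr_eq0 => /eqP.
Qed.

End stopped_brownian.

(** * Reflection and the law of the ruin time *)

Section drifted_gaussian.
Context {d : measure_display} {T : measurableType d} {R : realType}.
Variable P : probability T R.
Variables (s m u : R) (N : T -> R).
Hypotheses (s0 : 0 < s) (mN : measurable_fun setT N).
Hypothesis lawN : forall A, measurable A -> P (N @^-1` A) = normal_prob 0 s A.

Local Notation theta := (- (2 * m / s ^+ 2)).
Local Notation p := (Phi ((m - u) / s)).
Local Notation q := (expR (2 * m * u / s ^+ 2) * Phi ((- m - u) / s)).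

Let mNN : measurable_fun setT (fun w => - N w).
Proof. exact: measurableT_comp. Qed.

Let lawNN A : measurable A -> P ((fun w => - N w) @^-1` A) = normal_prob 0 s A.
Proof. by move=> mA; rewrite (gaussian_sym s0 mN lawN)// lawN. Qed.

Lemma drifted_up : P [set w | u <= m + N w] = p%:E.
Proof.
rewrite (_ : [set w | _] = [set w | u - m <= N w]).
  by rewrite (gaussian_ge s0 mN lawN) opprB.
by apply/seteqP; split => w /=; rewrite lerBlDl.
Qed.

(** Recentering the exponent at [u] produces the factor [exp(2 m u / s^2)], the origin of the
    exponential in [q]. *)
Let tilted (K : R -> R) : measurable_fun setT K -> (forall x, 0 <= K x) ->
  (\int[P]_w (expR (theta * (m + N w - u)) * K (m + N w))%:E =
   (expR (2 * m * u / s ^+ 2))%:E * \int[P]_w (K (- (m + N w)))%:E)%E.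
Proof.
move=> mK K0; rewrite (gaussian_tilt s0 mN lawN)//.
rewrite -ge0_integralZl_EFin//.
- apply: eq_integral => w _; rewrite -EFinM mulrA -expRD; congr (expR _ * _)%:E.
  by field; rewrite gt_eqF.
- by move=> w _; rewrite lee_fin mulr_ge0// expR_ge0.
- apply/measurable_EFinP; apply: measurable_funM.
    by apply: measurableT_comp => //; apply: measurable_funM => //; exact: measurable_funD.
  by apply: measurableT_comp => //; exact: measurable_funD.
Qed.

(** Tilting turns the integral into the constant times the probability of [m + N < - u], a Gaussian
    tail. *)
Lemma drifted_reflected :
  (\int[P]_w (expR (theta * (m + N w - u)) * (u < m + N w)%R%:R)%:E = q%:E)%E.
Proof.
have mK : measurable_fun setT (fun x : R => (u < x)%R%:R : R).
  rewrite (_ : (fun x => _) = \1_(`]u, +oo[%classic)); first exact: measurable_indic.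
  by apply/funext => x; rewrite indicE; congr (nat_of_bool _)%:R;
    apply/idP/idP; rewrite inE/= in_itv/= andbT.
rewrite (tilted mK)//.
rewrite EFinM; congr (_ * _)%E.
have mlt : measurable [set w | u + m < - N w].
  rewrite (_ : [set w | _] = (fun w => - N w) @^-1` `]u + m, +oo[); last first.
    by apply/seteqP; split => w /=; rewrite in_itv/= andbT.
  exact: measurable_preimage.
transitivity (P [set w | u + m < - N w]).
  transitivity (\int[P]_w (\1_[set w | u + m < - N w] w)%:E)%E; last first.
    by rewrite integral_indic// setIT.
  apply: eq_integral => w _; rewrite indicE.
  have -> : (u < - (m + N w)) = (w \in [set w | u + m < - N w]); last by [].
  by apply/idP/idP; rewrite inE/=; lra.
have -> : (- m - u) / s = - (u + m) / s by congr (_ / _); ring.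
rewrite -(gaussian_ge s0 mNN lawNN).
(* Strict and weak inequality differ by a single value, which has probability 0. *)
rewrite (_ : [set w | u + m <= - N w] =
  [set w | u + m < - N w] `|` (fun w => - N w) @^-1` [set u + m]).
  rewrite measureU0//; first exact: measurable_preimage.
  exact: (gaussian_set1 lawNN).
apply/seteqP; split => w /=.
  by rewrite le_eqVlt => /orP[/eqP->|]; [right|left].
by move=> [/ltW//|->].
Qed.

Lemma drifted_call :
  (\int[P]_w (Num.max (m + N w - u) 0)%:E =
   (s ^+ 2 * normal_pdf 0 s (m - u) + (m - u) * p)%:E)%E.
Proof.
rewrite -(gaussian_call s0 (m - u) mN lawN); apply: eq_integral => w _.
by congr (Num.max _ _)%:E; ring.
Qed.

(** [exp(2 m u / s^2)] times the density at [- m - u] is the density at [m - u]. The density term is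
    therefore the one of [drifted_call], and the two cancel in the mean of the ruin time. *)
Lemma drifted_reflected_call :
  (\int[P]_w (expR (theta * (m + N w - u)) * Num.max (m + N w - u) 0)%:E =
   (s ^+ 2 * normal_pdf 0 s (m - u) + (- m - u) * q)%:E)%E.
Proof.
rewrite (@tilted (fun x => Num.max (x - u) 0)); last 2 first.
- by apply: measurable_maxr => //; exact: measurable_funB.
- by move=> x; rewrite le_max lexx orbT.
have -> : (\int[P]_w (Num.max (- (m + N w) - u) 0)%:E =
    \int[P]_w (Num.max (- N w + (- m - u)) 0)%:E)%E.
  by apply: eq_integral => w _; congr (Num.max _ _)%:E; ring.
rewrite (gaussian_call s0 (- m - u) mNN lawNN) -EFinM; congr EFin.
rewrite mulrDr; congr (_ + _); last by ring.
rewrite mulrCA; congr (_ * _); rewrite !normal_pdf0E// mulrCA -expRD.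
by congr (_ * expR _); field; rewrite gt_eqF.
Qed.

End drifted_gaussian.

(** * Reflection principle for the sum with drift *)

Section reflection.
Context {dO : measure_display} {Omega : measurableType dO} {R : realType}.
Variable P : probability Omega R.
Variables (d : nat) (B : 'I_d -> R -> {RV P >-> R}) (Sigma : 'M[R]_d).
Hypothesis hB : brownian_motion B Sigma.
Variables (r_ : 'I_d -> R) (u T : R).
Hypotheses (u0 : 0 < u) (T0 : 0 < T).
Local Notation sigma2 := (\sum_(i < d) \sum_(j < d) Sigma i j).
Hypothesis sigma2_gt0 : 0 < sigma2.

Local Notation r := (\sum_(i < d) r_ i).
Local Notation S := (aggregate (risk B r_)).
Local Notation A := (hit S u T).
Local Notation tau := (fun w => fine (ruin_time S u w)).
Local Notation X_ s t w := (comb (@ones R d) (increment B s t w)).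
Local Notation theta := (- (2 * r / sigma2)).

Let cS : continuous_paths S := @continuous_aggregate _ _ _ P d B Sigma hB r_.
Let mS : forall t, measurable_fun setT (S t) := @measurable_aggregate _ _ _ P d B r_.
Let mA : measurable A := measurable_hit u cS mS T.

Lemma comb_ones_law t C : 0 <= t -> t < T -> measurable C ->
  P ((fun w => X_ t T w) @^-1` C) = normal_prob 0 (Num.sqrt ((T - t) * sigma2)) C.
Proof.
move=> t0 tT mC; rewrite (comb_law hB (@ones R d) t0 tT mC) /normal_law.
have -> : quad Sigma (@ones R d) = sigma2.
  by apply: eq_bigr => i _; apply: eq_bigr => j _; rewrite !mul1r.
by rewrite mulf_eq0 subr_eq0 (gt_eqF tT) (gt_eqF sigma2_gt0).
Qed.

Lemma aggregateB t w : S T w - S t w = r * (T - t) + X_ t T w.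
Proof. by rewrite !aggregateE comb_onesE; ring. Qed.

Section test_function.
Variables (K : R -> R) (C M : R).
Hypotheses (cK : continuous K) (K0 : forall y, 0 <= K y) (KC : forall y, K y <= C).
Hypotheses (Kneg : forall y, y <= 0 -> K y = 0) (Kbig : forall y, M <= y -> K y = 0).

Let G (y : R) := expR (theta * y) * K y.
(** The exponential in [G] may be unbounded; it matters only between [0] and [M], where [K] can be
    nonzero. *)
Let C1 := expR (`|theta| * `|M|) * C.

Let mK : measurable_fun setT K.
Proof. exact: continuous_measurable_fun. Qed.

Let mG : measurable_fun setT G.
Proof. by apply: measurable_funM => //; apply: measurableT_comp => //; exact: measurable_funM. Qed.

Let C0 : 0 <= C. Proof. exact: le_trans (K0 0) (KC 0). Qed.

Let G0 y : 0 <= G y. Proof. by rewrite mulr_ge0// expR_ge0. Qed.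

Let GC y : G y <= C1.
Proof.
rewrite /G /C1; have [y0|y0] := leP y 0; first by rewrite Kneg// mulr0 mulr_ge0// expR_ge0.
have [yM|My] := leP M y; first by rewrite Kbig// mulr0 mulr_ge0// expR_ge0.
apply: ler_pM => //.
rewrite ler_expR (le_trans (ler_norm _))// normrM ler_wpM2l//.
by rewrite gtr0_norm// (le_trans (ltW My))// ler_norm.
Qed.

Let cG : continuous G.
Proof.
move=> y; apply: cvgM; last exact: cK.
apply: (cvg_comp (fun y : R => theta * y) expR); last exact: continuous_expR.
by apply: cvgMl_tmp; exact: cvg_id.
Qed.

Let bound_int (f : R -> R) (g : Omega -> R) E D : measurable E -> measurable_fun setT f ->
  measurable_fun setT g -> (forall y, 0 <= f y) -> (forall y, f y <= D) ->
  P.-integrable E (EFin \o (fun w => f (g w))).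
Proof.
move=> mE mf mg f0 fD; apply: (@bounded_integrable_R _ _ _ P E _ D mE).
  by apply: measurable_funTS; exact: measurableT_comp.
by move=> w _; rewrite ger0_norm.
Qed.

(** By tilting, [h y = K (- y) - G y] has mean zero at [y = S T - S t] for [t < T], so optional
    stopping applies. Since [S = u] at [tau], the two sides agree on [A]; off [A] the path ends
    below [u], where [G] vanishes, so the right-hand integral extends to the whole space. *)
Lemma reflection_test : \int[P]_(w in A) K (u - S T w) =
  \int[P]_w (expR (theta * (S T w - u)) * K (S T w - u)).
Proof.
pose h y := K (- y) - G y.
have mh : measurable_fun setT h.
  by apply: measurable_funB => //; apply: measurableT_comp => //; exact: measurableT_comp.
have hb y : `|h y| <= C + C1.
  rewrite /h ler_norml; have := K0 (- y); have := KC (- y); have := G0 y; have := GC y.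
  by move=> *; apply/andP; split; lra.
have h00 : h 0 = 0 by rewrite /h /G oppr0 Kneg// mulr0 subrr.
pose F t w := h (S T w - S t w).
pose f t (v : d.-tuple R) := h (r * (T - t) + comb (@ones R d) v).
have mf t : measurable_fun setT (f t).
  by apply: measurableT_comp => //; apply: measurable_funD => //; exact: measurable_comb.
have FE t : F t = (fun w => f t (increment B t T w)).
  by apply/funext => w; rewrite /F aggregateB.
have mF t : measurable_fun setT (F t).
  by apply: measurableT_comp => //; exact: measurable_funB.
have iF t : P.-integrable setT (EFin \o F t).
  by apply: (@bounded_integrable_R _ _ _ P setT _ (C + C1)) => // w _; exact: hb.
have hb2 y : h y ^+ 2 <= (C + C1) ^+ 2.
  by rewrite -[h y ^+ 2]real_normK ?num_real// lerXn2r// nnegrE (le_trans _ (hb y)).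
have iF2 t : P.-integrable setT (EFin \o (fun w => (F t w ^+ 2)%R)).
  have mF2 : measurable_fun setT (fun w => F t w ^+ 2) by exact: measurable_funX.
  apply: (bounded_integrable_R P (M := (C + C1) ^+ 2) measurableT mF2) => w _.
  by rewrite ger0_norm ?sqr_ge0//; exact: hb2.
have FT w : F T w = 0 by rewrite /F subrr.
have Fzero t : 0 <= t -> t < T -> \int[P]_w F t w = 0.
  move=> t0 tT.
  have s0 : 0 < Num.sqrt ((T - t) * sigma2) by rewrite sqrtr_gt0 mulr_gt0// subr_gt0.
  have mX := measurable_comb_increment B (@ones R d) t T.
  have tilt := gaussian_tilt s0 mX (fun C => comb_ones_law t0 tT (C := C)) (r * (T - t)) mK K0.
  rewrite /F /h; under eq_Rintegral do rewrite aggregateB.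
  have mY : measurable_fun setT (fun w => r * (T - t) + X_ t T w) by exact: measurable_funD.
  rewrite RintegralB//; last 2 first.
  - apply: (bound_int (f := fun y => K (- y)) measurableT _ mY) => //.
    by apply: measurableT_comp => //; exact: measurableT_comp.
  - exact: (bound_int measurableT mG mY G0 GC).
  (* Mean [r (T - t)] and variance [(T - t) sigma2] have a ratio free of [t], so one tilt serves all
     remaining times. *)
  have thetaE : 2 * (r * (T - t)) / Num.sqrt ((T - t) * sigma2) ^+ 2 = 2 * r / sigma2.
    rewrite sqr_sqrtr ?mulr_ge0 ?subr_ge0 ?ltW//.
    by field; rewrite subr_eq0 (gt_eqF tT) (gt_eqF sigma2_gt0).
  rewrite thetaE in tilt.
  by apply/eqP; rewrite subr_eq0; apply/eqP; rewrite /Rintegral tilt.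
have CC0 : 0 <= (C + C1) ^+ 2 by exact: sqr_ge0.
have cF : seq_continuous T F.
  move=> w s t_ s0 tn ts; rewrite /F.
  have SY : (fun n => S T w - S (t_ n) w) @ \oo --> S T w - S s w.
    apply: cvgB; first exact: cvg_cst.
    exact: (seq_continuous_path cS s0 tn ts).
  rewrite /h; apply: cvgB.
    apply: (cvg_comp (fun n => - (S T w - S (t_ n) w)) K); last exact: cK.
    exact: cvgN.
  exact: (cvg_comp (fun n => S T w - S (t_ n) w) G SY (@cG _)).
have [|||iFt H] := @stopped_martingale _ _ _ S u cS mS T T0 P F ((C + C1) ^+ 2) cF
    (fun t _ => mF t) (fun t _ => iF2 t) CC0.
- move=> t _; apply: (@le_trans _ _ (\int[P]_w ((C + C1) ^+ 2))).
    apply: (le_Rintegral measurableT (iF2 t)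
      (finite_measure_integrable_cst P ((C + C1) ^+ 2) measurableT)) => w _.
    exact: hb2.
  rewrite Rintegral_cst//; rewrite [X in fine X]probability_setT mulr1//.
- move=> s t st; have /andP[s0 st'] := st; have t0 := le_trans s0 st'.
  rewrite le_eqVlt => /orP[/eqP ->|tT].
    by under eq_Rintegral do rewrite FT; rewrite Rintegral_cst ?mul0r//; exact: measurable_hit.
  have := Fzero _ t0 tT; have := iF t; rewrite FE => h1 h2.
  by rewrite (future_hit hB r_ u0 st tT (mf t))// h2 mulr0.
- move=> s t st; have /andP[s0 st'] := st; have t0 := le_trans s0 st'.
  rewrite le_eqVlt => /orP[/eqP ->|tT].
    under eq_Rintegral do rewrite FT expr0n.
    under [X in _ = _ * X]eq_Rintegral do rewrite FT expr0n.
    by rewrite !Rintegral_cst ?mul0r ?mulr0//; exact: measurable_hit.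
  have := iF2 t; rewrite FE => h1.
  rewrite (@future_hit _ _ _ P d B Sigma hB r_ u T u0 _ _ (fun v => f t v ^+ 2) st tT)//.
  exact: measurable_funX.
have [N [mN PN N0 Su]] := aggregate_tau hB r_ u0 T0.
have mYu : measurable_fun setT (fun w => S T w - u) by exact: measurable_funB.
have mYu' : measurable_fun setT (fun w => u - S T w) by exact: measurable_funB.
have iK : P.-integrable A (EFin \o (fun w => K (u - S T w))).
  exact: (bound_int mA mK mYu' K0 KC).
have iG E : measurable E -> P.-integrable E (EFin \o (fun w => G (S T w - u))).
  by move=> mE; exact: (bound_int mE mG mYu G0 GC).
have : \int[P]_(w in A) (K (u - S T w) - G (S T w - u)) = 0.
  rewrite -H; apply: (@Rintegral_ae _ _ _ P A N) => //.
    by have := integrableB mA iK (iG _ mA).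
  by move=> w Aw nw; rewrite /F Su// /h opprB.
rewrite RintegralB//; last exact: iG.
move=> /eqP; rewrite subr_eq0 => /eqP ->.
rewrite Rintegral_mkcond; apply: eq_Rintegral => w _; rewrite patchE.
case: ifPn => // /negP nA; rewrite -/(G _) /G Kneg ?mulr0//.
rewrite leNgt; apply/negP => h1; apply: nA; rewrite inE.
by exists T; rewrite ?lexx ?(ltW T0)//; lra.
Qed.

End test_function.

(** Passes from test functions to a [g] that may jump at 0 or be unbounded: on [y > 0] the
    continuous [h_] approach [g] from below, and both sides converge by domination. *)
Lemma reflection_limit (h_ : nat -> R -> R) (g : R -> R) :
  (forall n, continuous (h_ n)) -> (forall n y, y <= 0 -> h_ n y <= 0) ->
  measurable_fun setT g -> (forall y, y <= 0 -> g y = 0) ->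
  (forall n y, 0 < y -> h_ n y <= g y) -> (forall y, 0 <= g y) ->
  (forall y, 0 < y -> \forall n \near \oo, h_ n y = g y) ->
  P.-integrable A (EFin \o (fun w => g (u - S T w))) ->
  P.-integrable setT (EFin \o (fun w => expR (theta * (S T w - u)) * g (S T w - u))) ->
  (exists D, forall y, g y <= D + `|y|) ->
  \int[P]_(w in A) g (u - S T w) =
  \int[P]_w (expR (theta * (S T w - u)) * g (S T w - u)).
Proof.
move=> ch hneg mg gneg hg g0 hcvg ig1 ig2 [D gD].
(* The term [n + 1 - y] provides bounded support and the bound [n + 1]; the maximum with 0 removes
   the negative half-line. *)
pose K n y := Num.max 0 (Num.min (h_ n y) (n.+1%:R - y)).
have cK n : continuous (K n).
  move=> y; apply: cvg_maxr; first exact: cvg_cst.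
  apply: cvg_minr; first exact: ch.
  by apply: cvgB; [exact: cvg_cst|exact: cvg_id].
have K0 n y : 0 <= K n y by rewrite /K le_max lexx.
have Kneg n y : y <= 0 -> K n y = 0.
  by move=> y0; rewrite /K max_l// ge_min hneg.
have Kbig n y : n.+1%:R <= y -> K n y = 0.
  by move=> y0; rewrite /K max_l// ge_min subr_le0 y0 orbT.
have KC n y : K n y <= n.+1%:R.
  have [y0|y0] := leP y 0; first by rewrite Kneg.
  by rewrite /K ge_max ler0n/= ge_min gerBl (ltW y0) orbT.
have Kg n y : K n y <= g y.
  have [y0|y0] := leP y 0; first by rewrite Kneg.
  by rewrite /K ge_max g0/= ge_min hg.
have Kcvg y : K ^~ y @ \oo --> g y.
  have [y0|y0] := leP y 0.
    by rewrite gneg//; under eq_fun do rewrite Kneg//; exact: cvg_cst.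
  apply: cvg_near_cst; near=> n.
  have hn : h_ n y = g y by near: n; exact: hcvg.
  rewrite /K hn min_l ?max_r//.
  rewrite lerBrDr; apply: (@le_trans _ _ (D + `|y| + y)); first by rewrite lerD2r.
  near: n; exists (Num.trunc (D + `|y| + y)) => // n /= nn.
  by rewrite ltW// -truncn_le_nat.
have mK n : measurable_fun setT (K n) by exact: continuous_measurable_fun.
have mY : measurable_fun setT (fun w => S T w - u) by exact: measurable_funB.
have mY' : measurable_fun setT (fun w => u - S T w) by exact: measurable_funB.
have me : measurable_fun setT (fun w => expR (theta * (S T w - u))).
  by apply: measurableT_comp => //; exact: measurable_funM.
have Kb n w : A w -> `|K n (u - S T w)| <= g (u - S T w) by rewrite ger0_norm.
have c1 : {ae P, forall w, A w -> K ^~ (u - S T w) @ \oo --> g (u - S T w)}.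
  by apply: aeW => w _; exact: Kcvg.
have [_ H1] := @Rintegral_dominated_cvg _ _ _ P A (fun n w => K n (u - S T w))
  (fun w => g (u - S T w)) (fun w => g (u - S T w)) mA
  (fun n => measurable_funTS (measurableT_comp (mK n) mY'))
  (measurable_funTS (measurableT_comp mg mY')) ig1 c1 Kb.
pose G_ n w := expR (theta * (S T w - u)) * K n (S T w - u).
pose G w := expR (theta * (S T w - u)) * g (S T w - u).
have Gb n w : setT w -> `|G_ n w| <= G w.
  by move=> _; rewrite ger0_norm ?mulr_ge0 ?expR_ge0// ler_wpM2l// expR_ge0.
have c2 : {ae P, forall w, setT w -> G_ ^~ w @ \oo --> G w}.
  by apply: aeW => w _; apply: cvgMl_tmp; exact: Kcvg.
have [_ H2] := @Rintegral_dominated_cvg _ _ _ P setT G_ G G measurableT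
  (fun n => measurable_funM me (measurableT_comp (mK n) mY))
  (measurable_funM me (measurableT_comp mg mY)) ig2 c2 Gb.
rewrite -(cvg_lim _ H1)// -(cvg_lim _ H2)//; congr (lim (_ @ \oo)).
apply/funext => n; exact: (reflection_test (cK n) (K0 n) (KC n) (Kneg n) (Kbig n)).
Unshelve. all: by end_near. Qed.

End reflection.

(** * Ruin probability and mean ruin time *)

Section ruin_values.
Context {dO : measure_display} {Omega : measurableType dO} {R : realType}.
Variable P : probability Omega R.
Variables (d : nat) (B : 'I_d -> R -> {RV P >-> R}) (Sigma : 'M[R]_d).
Hypothesis hB : brownian_motion B Sigma.
Variables (r_ : 'I_d -> R) (u T : R).
Hypotheses (u0 : 0 < u) (T0 : 0 < T).
Local Notation sigma2 := (\sum_(i < d) \sum_(j < d) Sigma i j).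
Hypothesis sigma2_gt0 : 0 < sigma2.

Local Notation r := (\sum_(i < d) r_ i).
Local Notation S := (aggregate (risk B r_)).
Local Notation A := (hit S u T).
Local Notation tau := (fun w => fine (ruin_time S u w)).
Local Notation N := (fun w => comb (@ones R d) (increment B 0 T w)).
Local Notation theta := (- (2 * r / sigma2)).
Local Notation s := (Num.sqrt (T * sigma2)).
Local Notation m := (r * T).
Local Notation p := (Phi ((- u + r * T) / (Num.sqrt sigma2 * Num.sqrt T))).
Local Notation q := (expR (2 * u * r / sigma2) *
  Phi ((- u - r * T) / (Num.sqrt sigma2 * Num.sqrt T))).

Let cS : continuous_paths S := @continuous_aggregate _ _ _ P d B Sigma hB r_.
Let mS : forall t, measurable_fun setT (S t) := @measurable_aggregate _ _ _ P d B r_.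
Let mA : measurable A := measurable_hit u cS mS T.

Let s0 : 0 < s. Proof. by rewrite sqrtr_gt0 mulr_gt0. Qed.

Let s2 : s ^+ 2 = T * sigma2.
Proof. by rewrite sqr_sqrtr// mulr_ge0 ?ltW. Qed.

Let sE : s = Num.sqrt sigma2 * Num.sqrt T.
Proof. by rewrite mulrC sqrtrM// ltW. Qed.

Let mN : measurable_fun setT N.
Proof. exact: measurable_comb_increment. Qed.

Let lawN C : measurable C -> P (N @^-1` C) = normal_prob 0 s C.
Proof.
move=> mC; have := comb_ones_law hB sigma2_gt0 (lexx 0) T0 mC.
by rewrite subr0.
Qed.

Let thetaE : 2 * m / s ^+ 2 = 2 * r / sigma2.
Proof. by rewrite s2; field; rewrite (gt_eqF T0) (gt_eqF sigma2_gt0). Qed.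

Let pE : Phi ((m - u) / s) = p.
Proof. by rewrite sE addrC. Qed.

Let qE : expR (2 * m * u / s ^+ 2) * Phi ((- m - u) / s) = q.
Proof.
rewrite sE (_ : - m - u = - u - r * T); last by ring.
rewrite -sE s2; congr (expR _ * _).
by field; rewrite (gt_eqF T0) (gt_eqF sigma2_gt0).
Qed.

(* S T and m + N differ only by the initial value of B, which is a.s. 0. *)
Lemma terminal_value (f : R -> R) (c : R) : measurable_fun setT f ->
  (forall x, 0 <= f x) -> (\int[P]_w (f (m + N w))%:E = c%:E)%E ->
  P.-integrable setT (EFin \o (fun w => f (S T w))) /\ \int[P]_w f (S T w) = c.
Proof.
move=> mf f0 fc; have [Z [mZ PZ Z0]] := start_null hB.
have mfS : measurable_fun setT (fun w => f (S T w)) by exact: measurableT_comp.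
have mfN : measurable_fun setT (fun w => f (m + N w)).
  by apply: measurableT_comp => //; exact: measurable_funD.
have E : (\int[P]_w (f (S T w))%:E = c%:E)%E.
  rewrite -fc; apply: (@ae_eq_integral _ _ _ P setT (EFin \o (fun w => f (m + N w)))
    (EFin \o (fun w => f (S T w))) measurableT).
  - exact/measurable_EFinP.
  - exact/measurable_EFinP.
  exists Z; split => // w /= nw; apply: contrapT => Zw; apply: nw => _.
  rewrite comb_onesE [X in _ - X]big1 ?subr0 ?aggregateE//.
  by move=> i _; exact: Z0.
split; last by rewrite /Rintegral E.
apply/integrableP; split; first exact/measurable_EFinP.
under eq_integral do rewrite /= ger0_norm//.
by rewrite E ltry.
Qed.

Let mexp : measurable_fun setT (fun x : R => expR (theta * (x - u))).
Proof. by apply: measurableT_comp => //; apply: measurable_funM => //; exact: measurable_funB. Qed.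

Let mlt : measurable_fun setT (fun x : R => (0 < x)%R%:R : R).
Proof.
rewrite (_ : (fun x => _) = \1_(`]0, +oo[%classic)); first exact: measurable_indic.
by apply/funext => x; rewrite indicE; congr (nat_of_bool _)%:R;
  apply/idP/idP; rewrite inE/= in_itv/= andbT.
Qed.

Let mle : measurable_fun setT (fun x : R => (u <= x)%R%:R : R).
Proof.
rewrite (_ : (fun x => _) = \1_(`[u, +oo[%classic)); first exact: measurable_indic.
by apply/funext => x; rewrite indicE; congr (nat_of_bool _)%:R;
  apply/idP/idP; rewrite inE/= in_itv/= andbT.
Qed.

Let mmax : measurable_fun setT (fun x : R => Num.max x 0).
Proof. exact: measurable_maxr. Qed.

Let msub : measurable_fun setT (fun x : R => x - u).
Proof. exact: measurable_funB. Qed.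

Let value_up : P.-integrable setT (EFin \o (fun w => (u <= S T w)%R%:R)) /\
  \int[P]_w (u <= S T w)%R%:R = p.
Proof.
apply: (@terminal_value (fun x => (u <= x)%R%:R)) => //.
have mup : measurable [set w | u <= m + N w].
  rewrite (_ : [set w | _] = (fun w => m + N w) @^-1` `[u, +oo[); last first.
    by apply/seteqP; split => w /=; rewrite in_itv/= andbT.
  by apply: measurable_preimage => //; exact: measurable_funD.
rewrite -pE -(drifted_up m u s0 mN lawN).
transitivity (\int[P]_w (\1_[set w | u <= m + N w] w)%:E)%E; last first.
  by rewrite integral_indic// setIT.
apply: eq_integral => w _; rewrite indicE.
have -> : (u <= m + N w) = (w \in [set w | u <= m + N w]); last by [].
by apply/idP/idP; rewrite inE.
Qed.

Let value_reflected :
  P.-integrable setT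
    (EFin \o (fun w => expR (theta * (S T w - u)) * (0 < S T w - u)%R%:R)) /\
  \int[P]_w (expR (theta * (S T w - u)) * (0 < S T w - u)%R%:R) = q.
Proof.
apply: (@terminal_value (fun x => expR (theta * (x - u)) * (0 < x - u)%R%:R)).
- by apply: measurable_funM => //; exact: measurableT_comp mlt msub.
- by move=> x; rewrite mulr_ge0// expR_ge0.
have := drifted_reflected m u s0 mN lawN; rewrite thetaE qE => <-.
by apply: eq_integral => w _; rewrite subr_gt0.
Qed.

Local Notation c := (s ^+ 2 * normal_pdf 0 s (m - u)).

Let value_call : P.-integrable setT (EFin \o (fun w => Num.max (S T w - u) 0)) /\
  \int[P]_w Num.max (S T w - u) 0 = c + (m - u) * p.
Proof.
apply: (@terminal_value (fun x => Num.max (x - u) 0)).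
- exact: measurableT_comp mmax msub.
- by move=> x; rewrite le_max lexx orbT.
by rewrite (drifted_call m u s0 mN lawN) pE.
Qed.

Let value_reflected_call :
  P.-integrable setT
    (EFin \o (fun w => expR (theta * (S T w - u)) * Num.max (S T w - u) 0)) /\
  \int[P]_w (expR (theta * (S T w - u)) * Num.max (S T w - u) 0) = c + (- m - u) * q.
Proof.
apply: (@terminal_value (fun x => expR (theta * (x - u)) * Num.max (x - u) 0)).
- by apply: measurable_funM => //; exact: measurableT_comp mmax msub.
- by move=> x; rewrite mulr_ge0// ?expR_ge0// le_max lexx orbT.
by have := drifted_reflected_call m u s0 mN lawN; rewrite thetaE qE.
Qed.

Let hitT w : u <= S T w -> A w.
Proof. by move=> h; exists T; rewrite // lexx ltW. Qed.

(** A path that ends at or above [u] has hit the level by [T], so restricting to [A] changes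
    nothing. *)
Let Rintegral_above (f : R -> R) : (forall x, x < u -> f x = 0) ->
  \int[P]_(w in A) f (S T w) = \int[P]_w f (S T w).
Proof.
move=> f0; rewrite Rintegral_mkcond; apply: eq_Rintegral => w _; rewrite patchE.
case: ifPn => // /negP nA; rewrite f0// ltNge; apply/negP => /hitT Aw.
by apply: nA; rewrite inE.
Qed.

Let prob_below : \int[P]_(w in A) (0 < u - S T w)%R%:R = q.
Proof.
rewrite -value_reflected.2.
(* [min(1, n y)] is continuous and equals the indicator of [y > 0] once [n >= 1 / y]. *)
apply: (reflection_limit hB u0 T0 sigma2_gt0
  (h_ := fun n y => Num.min 1 (n%:R * y)) (g := fun y => (0 < y)%R%:R)).
- move=> n y; apply: cvg_minr; first exact: cvg_cst.
  by apply: cvgMl_tmp; exact: cvg_id.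
- by move=> n y y0; rewrite ge_min mulr_ge0_le0 ?orbT.
- exact: mlt.
- by move=> y y0; rewrite ltNge y0.
- by move=> n y y0; rewrite y0 ge_min lexx.
- by move=> y; exact: ler0n.
- move=> y y0; rewrite y0.
  exists (Num.trunc y^-1).+1 => // n /= nn; rewrite min_l//.
  rewrite -ler_pdivrMr// div1r ltW//.
  by apply: (lt_le_trans (truncnS_gt _)); rewrite ler_nat.
- apply: (bounded_integrable_R P (M := 1) mA).
    by apply: measurable_funTS; apply: (measurableT_comp mlt); exact: measurable_funB.
  by move=> w _; case: (0 < _); rewrite ?normr1 ?normr0.
- exact: value_reflected.1.
- by exists 1 => y; case: (0 < y); rewrite ?lerDl// addr_ge0.
Qed.

Let excess_below : \int[P]_(w in A) Num.max (u - S T w) 0 = c + (- m - u) * q.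
Proof.
rewrite -value_reflected_call.2.
have iST : P.-integrable A (EFin \o S T).
  have iB i : P.-integrable A (EFin \o risk B r_ i T).
    have := integrableD mA (finite_measure_integrable_cst P (r_ i * T) mA)
      (integrable_B hB i mA (ltW T0)).
    by [].
  exact: (Rintegral_finite_sum mA iB).1.
(* The identity is an admissible approximation: nonpositive for [y <= 0], and equal to the positive
   part for [y > 0]. *)
apply: (reflection_limit hB u0 T0 sigma2_gt0
  (h_ := fun n y => y) (g := fun y => Num.max y 0)).
- by move=> n y; exact: cvg_id.
- by [].
- exact: mmax.
- by move=> y y0; rewrite max_r.
- by move=> n y y0; rewrite le_max lexx.
- by move=> y; rewrite le_max lexx orbT.
- by move=> y y0; apply: nearW => n; rewrite max_l// ltW.
- have iuS : P.-integrable A (EFin \o (fun w => u - S T w)).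
    by have := integrableB mA (finite_measure_integrable_cst P u mA) iST.
  apply: (dominated_integrable_R mA _ _ (integrable_norm iuS)).
    by apply: measurable_funTS; apply: (measurableT_comp mmax); exact: measurable_funB.
  move=> w _ /=; rewrite ger0_norm ?le_max ?lexx ?orbT//.
  by rewrite ge_max ler_norm normr_ge0.
- exact: value_reflected_call.1.
- by exists 0 => y; rewrite add0r ge_max ler_norm normr_ge0.
Qed.

Lemma ruin_probability : fine (P A) = p + q.
Proof.
rewrite -[LHS]mul1r -Rintegral_cst//.
have i1 : P.-integrable A (EFin \o (fun w => (0 < u - S T w)%R%:R)).
  apply: (bounded_integrable_R P (M := 1) mA).
    by apply: measurable_funTS; apply: (measurableT_comp mlt); exact: measurable_funB.
  by move=> w _; case: (0 < _); rewrite ?normr1 ?normr0.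
have i2 : P.-integrable A (EFin \o (fun w => (u <= S T w)%R%:R)).
  exact: integrableS value_up.1.
rewrite (_ : \int[P]_(w in A) _ =
    \int[P]_(w in A) ((u <= S T w)%R%:R + (0 < u - S T w)%R%:R)); last first.
  apply: eq_Rintegral => w _; rewrite subr_gt0.
  by have [h|h] := leP u (S T w); rewrite ?addr0 ?add0r.
rewrite RintegralD// prob_below (@Rintegral_above (fun x => (u <= x)%R%:R)) ?value_up.2//.
by move=> x xu; rewrite leNgt xu.
Qed.

Lemma ruin_time_mean : r * \int[P]_(w in A) tau w = u * (p - q).
Proof.
have iB i : P.-integrable A (EFin \o risk B r_ i T).
  have := integrableD mA (finite_measure_integrable_cst P (r_ i * T) mA)
    (integrable_B hB i mA (ltW T0)).
  by [].
have iST : P.-integrable A (EFin \o S T) := (Rintegral_finite_sum mA iB).1.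
have icall : P.-integrable A (EFin \o (fun w => Num.max (S T w - u) 0)).
  exact: integrableS value_call.1.
have iput : P.-integrable A (EFin \o (fun w => Num.max (u - S T w) 0)).
  have iuS : P.-integrable A (EFin \o (fun w => u - S T w)).
    by have := integrableB mA (finite_measure_integrable_cst P u mA) iST.
  apply: (dominated_integrable_R mA _ _ (integrable_norm iuS)).
    by apply: measurable_funTS; apply: (measurableT_comp mmax); exact: measurable_funB.
  move=> w _ /=; rewrite ger0_norm ?le_max ?lexx ?orbT//.
  by rewrite ge_max ler_norm normr_ge0.
(* Positive part minus negative part: the density terms [c] cancel. *)
have e1 : \int[P]_(w in A) (S T w - u) = (m - u) * p + (m + u) * q.
  rewrite (_ : \int[P]_(w in A) _ =
      \int[P]_(w in A) (Num.max (S T w - u) 0 - Num.max (u - S T w) 0)); last first.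
    apply: eq_Rintegral => w _.
    have [h|h] := leP (S T w - u) 0; have [h'|h'] := leP (u - S T w) 0; lra.
  rewrite RintegralB// excess_below (@Rintegral_above (fun x => Num.max (x - u) 0)).
    by rewrite value_call.2; ring.
  by move=> x xu; rewrite max_r// subr_le0 ltW.
(* On [A] optional stopping replaces [B i T] by [B i] at [tau], and the level identity sums these
   components. *)
have e2 : \int[P]_(w in A) S T w =
    m * (p + q) + (u * (p + q) - r * \int[P]_(w in A) tau w).
  rewrite -ruin_probability -(sum_stopped hB r_ u0 T0).
  rewrite (Rintegral_finite_sum mA iB).2.
  rewrite -Rintegral_cst//.
  transitivity (\sum_(i < d) (r_ i * T * fine (P A) + \int[P]_(w in A) B i (tau w) w)).
    apply: eq_bigr => i _; rewrite (stopped_component hB r_ u0 T0 i).2.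
    rewrite -Rintegral_cst// -RintegralD//.
    - exact: finite_measure_integrable_cst.
    - exact: (integrable_B hB i mA (ltW T0)).
  by rewrite big_split/= Rintegral_cst// mulr_suml mulr_suml.
move: e1; rewrite RintegralB//; last exact: finite_measure_integrable_cst.
rewrite Rintegral_cst// ruin_probability e2 => e1.
by lra.
Qed.

(** [p] is a tail of a nondegenerate Gaussian law, hence positive; conditioning on [A] thereby makes
    sense. *)
Lemma ruin_probability_gt0 : 0 < fine (P A).
Proof.
have pP := drifted_up m u s0 mN lawN.
have p0 : 0 < p.
  rewrite -pE -lte_fin -pP.
  rewrite (_ : [set w | _] = [set w | u - m <= N w]).
    exact: (gaussian_ge_gt0 s0 lawN).
  by apply/seteqP; split => w /=; rewrite lerBlDl.
have q0 : 0 <= q.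
  by rewrite mulr_ge0 ?expR_ge0// /Phi fine_ge0.
by rewrite ruin_probability; lra.
Qed.

End ruin_values.

(** With positive [P A] the extended-real quotient is the real one. Only values on [A] enter, so
    [tau], possibly infinite elsewhere, can be replaced by its real part. *)
Lemma cond_expectationE (dO : measure_display) (Omega : measurableType dO)
    (R : realType) (P : probability Omega R) (X : Omega -> \bar R) (f : Omega -> R)
    (A : set Omega) : measurable A -> 0 < fine (P A) ->
  P.-integrable A (EFin \o f) -> (forall w, A w -> X w = (f w)%:E) ->
  cond_expectation P X A = (\int[P]_(w in A) f w / fine (P A))%:E.
Proof.
move=> mA PA fi Xf; rewrite /cond_expectation.
have -> : (\int[P]_(w in A) X w = (\int[P]_(w in A) f w)%:E)%E.
  rewrite /Rintegral fineK; last exact: integrable_fin_num.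
  by apply: eq_integral => w; rewrite inE => /Xf.
have -> : P A = (fine (P A))%:E by rewrite fineK// fin_num_measure.
by rewrite inver gt_eqF// -EFinM.
Qed.

Theorem theorem3 (R : realType) (dO : measure_display)
    (Omega : measurableType dO) (P : probability Omega R)
    (d : nat) (hd : (2 <= d)%N)
    (r_ : 'I_d -> R) (Sigma : 'M[R]_d) (B : 'I_d -> R -> {RV P >-> R})
    (hB : brownian_motion B Sigma)
    (sigma2_gt0 : 0 < \sum_(i < d) \sum_(j < d) Sigma i j)
    (u T : R) (u_gt0 : 0 < u) (T_gt0 : 0 < T) :
  let S_ := fun (i : 'I_d) (t : R) (w : Omega) => r_ i * t + B i t w in
  let S := aggregate S_ in
  let r := \sum_(i < d) r_ i in
  let sigma2 := \sum_(i < d) \sum_(j < d) Sigma i j in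
  let sigma := Num.sqrt sigma2 in
  let tau := ruin_time S u in
  let A := ruin_event S u T in
  (forall i : 'I_d,
     let beta := (\sum_(j < d) Sigma i j) / sigma2 in
     allocation P S_ u T i = cond_expectation P (stopped (S_ i) tau) A /\
     cond_expectation P (stopped (S_ i) tau) A =
       (cond_expectation P tau A * (r_ i - beta * r)%:E + (beta * u)%:E)%E) /\
  (r != 0 ->
     let p := Phi ((- u + r * T) / (sigma * Num.sqrt T)) in
     let q := expR (2 * u * r / sigma2) *
              Phi ((- u - r * T) / (sigma * Num.sqrt T)) in
     cond_expectation P tau A = (u / r * ((p - q) / (p + q)))%:E).
Proof.
move=> S_ S r sigma2 sigma tau A.
have cS : continuous_paths S := @continuous_aggregate _ _ _ P d B Sigma hB r_.
have mS : forall t, measurable_fun setT (S t) := @measurable_aggregate _ _ _ P d B r_.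
have AE : A = hit S u T.
  by apply/seteqP; split => w /(ruin_time_le u cS w (ltW T_gt0)).
have mA : measurable A by rewrite AE; exact: measurable_hit.
have PA0 : 0 < fine (P A).
  rewrite AE; exact: (ruin_probability_gt0 hB r_ u_gt0 T_gt0 sigma2_gt0).
have itau : P.-integrable A (EFin \o (fun w => fine (tau w))).
  by rewrite AE; exact: (integrable_tau hB r_ u T_gt0).
have tauE : cond_expectation P tau A =
    (\int[P]_(w in A) fine (tau w) / fine (P A))%:E.
  apply: cond_expectationE => // w Aw; apply: (ruin_time_fin cS T_gt0).
  by rewrite -AE.
have iB i : P.-integrable A (EFin \o (fun w => B i (fine (tau w)) w)).
  by rewrite AE; exact: (stopped_component hB r_ u_gt0 T_gt0 i).1.
have irt i : P.-integrable A (EFin \o (fun w => r_ i * fine (tau w))).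
  by have := integrableZl mA (r_ i) itau.
have iS i : P.-integrable A (EFin \o (fun w => S_ i (fine (tau w)) w)).
  by have := integrableD mA (irt i) (iB i).
have SiE i : cond_expectation P (stopped (S_ i) tau) A =
    (\int[P]_(w in A) S_ i (fine (tau w)) w / fine (P A))%:E.
  exact: cond_expectationE.
have sumS : \int[P]_(w in A) S (fine (tau w)) w = u * fine (P A).
  have [N [mN PN _ Su]] := aggregate_tau hB r_ u_gt0 T_gt0.
  rewrite -Rintegral_cst//; apply: (@Rintegral_ae _ _ _ P A N) => //.
  - exact: (Rintegral_finite_sum mA iS).1.
  - exact: finite_measure_integrable_cst.
  - by rewrite AE; exact: Su.
(* The denominator of the allocation is [u], which the final factor [u] cancels. *)
have SE : cond_expectation P (stopped S tau) A = u%:E.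
  rewrite (@cond_expectationE _ _ _ P _ (fun w => S (fine (tau w)) w))//.
    by rewrite sumS mulfK// gt_eqF.
  exact: (Rintegral_finite_sum mA iS).1.
split=> [i beta|r0 p q].
  split.
    have uV : (u%:E^-1 = u^-1%:E)%E by rewrite inver gt_eqF.
    by rewrite /allocation -/S -/tau -/A SE SiE uV -!EFinM divfK// gt_eqF.
  rewrite SiE tauE -EFinM -EFinD; congr EFin.
  rewrite /S_ RintegralD// RintegralZl//.
  have := stopped_component_mean hB r_ u_gt0 T_gt0 i sigma2_gt0.
  rewrite -[aggregate _]/S -AE -/tau -/sigma2 -/beta -/r => ->.
  by field; rewrite gt_eqF.
have := ruin_time_mean hB r_ u_gt0 T_gt0 sigma2_gt0.
have := ruin_probability hB r_ u_gt0 T_gt0 sigma2_gt0.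
rewrite -[aggregate _]/S -AE -/tau -/sigma2 -/sigma -/r -/p -/q => PAE mean.
rewrite tauE PAE; congr EFin.
have pq0 : p + q != 0 by rewrite -PAE gt_eqF.
(* Only [r] times the integral of [tau] is known, so both sides are multiplied by [r]. *)
apply: (mulfI r0); rewrite [LHS]mulrA mean.
by field; rewrite r0 pq0.
Qed.
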